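(* Suppose that $L$ satisfies Assumption 1 and that $F,G$ satisfy Assumption 2 (both stated in the context). Then, for the given initial datum $(m_{x,0}(u))_{x\in\Sigma,u\in\mathcal U}$, the Mean Field Game equations $$ \begin{aligned} -\frac{d}{dt}V(t,x,u) &= -H(x,\nabla V(t,x,u),u)+F(x,m(t),u),\\ V(T,x,u) &= G(x,m(T),u),\\ \frac{d}{dt}m_x(t,u) &= \sum_{y\in\Sigma} m_y(t,u)\,a^*_x(y,\nabla V(t,y,u),u),\\ m_x(0,u) &= m_{x,0}(u), \end{aligned} $$ for $t\in[0,T]$, $x\in\Sigma$, $u\in\mathcal U$, admit a solution $(V,m)$.
   Context: Setting. $T>0$ is fixed; $\Sigma=\{1,\dots,d\}$ is a finite set; $\mathcal U$ is a compact metric space; $\mu$ is a Borel probability measure on $\mathcal U$. $P(\mathcal U\times\Sigma)$ is the set of probability measures on $\mathcal U\times\Sigma$ with the topology of weak convergence, and $\mathcal P_\mu\subset P(\mathcal U\times\Sigma)$ is the subset of those measures $m$ with first marginal $\mu$, i.e. $m(A\times\Sigma)=\mu(A)$ for all Borel $A\subseteq\mathcal U$. An element $m\in\mathcal P_\mu$ is written $m(x,du)=m_x(u)\mu(du)$, where $(m_x(u))_{x\in\Sigma}$ is a regular version of the conditional distribution on $\Sigma$ given $u$. Data: functions $L:\Sigma\times[0,+\infty)^\Sigma\times\mathcal U\to\mathbb R$ and $F,G:\Sigma\times P(\mathcal U\times\Sigma)\times\mathcal U\to\mathbb R$, and an initial datum $m_{x,0}(u)$, measurable in $u$, with $(m_{x,0}(u))_{x\in\Sigma}$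 a probability vector for every $u\in\mathcal U$. Notation. For $f:\Sigma\to\mathbb R$, $\nabla f(x)=(f(y)-f(x))_{y\in\Sigma}\in\mathbb R^\Sigma$; for $V(t,x,u)$, $\nabla V(t,x,u)=(V(t,y,u)-V(t,x,u))_{y\in\Sigma}$. The Hamiltonian $H:\Sigma\times\mathbb R^\Sigma\times\mathcal U\to\mathbb R$ is $$H(x,p,u)=-\inf_{a\in[0,+\infty)^\Sigma}\Big[\sum_{y\neq x}a_yp_y+L(x,a,u)\Big],$$ and $a^*(x,p,u)\in[0,+\infty)^\Sigma$ denotes the minimizer (unique under Assumption 1). In the equation for $m_x$, $a^*_x(y,\cdot,u)$ is, for $y\neq x$, the $x$-component of the minimizer $a^*(y,\cdot,u)$, i.e. the jump rate from $y$ to $x$, while the diagonal term $y=x$ is understood by the convention $a^*_x(x,\cdot,u)=-\sum_{y\neq x}a^*_y(x,\cdot,u)$; that is, the equation is the forward Kolmogorov equation $$\frac{d}{dt}m_x(t,u)=\sum_{y\ne x}\big[m_y(t,u)a^*_x(y,\nabla V(t,y,u),u)-m_x(t,u)a^*_y(x,\nabla V(t,x,u),u)\big].$$ A solution $(V,m)$ consists of a function $V:[0,T]\times\Sigma\times\mathcal U\to\mathbb R$ and a flow $m:[0,T]\to\mathcal P_\mu$, $m(t)(x,du)=m_x(t,u)\mu(du)$ with $(m_x(t,u))_x$ probability vectors measurable in $u$, such that the equations hold for every $u\in\mathcal U$. Assumption 1. $L$ is differentiable in its second variable with differential $\nabla_aL(x,a,u)$; both $L(x,a,u)$ and $\nabla_aL(x,a,u)$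 are continuous in $u$; and there is $\gamma>0$ such that for all $x\in\Sigma$, $a,a'\in[0,+\infty)^\Sigma$, $u\in\mathcal U$, $$L(x,a',u)\ge L(x,a,u)+\nabla_aL(x,a,u)\cdot(a'-a)+\gamma\|a'-a\|^2 .$$ Assumption 2. $F$ and $G$ are bounded and, for each $x\in\Sigma$, are continuous in $(m,u)$ on $\mathcal P_\mu\times\mathcal U$. *)

(* Defs.v *)
From HB Require Import structures.
From mathcomp Require Import all_boot all_order all_algebra.
From mathcomp Require Import all_classical all_reals all_analysis.
Import Order.TTheory GRing.Theory Num.Theory.
Import numFieldNormedType.Exports.

Set Implicit Arguments.
Unset Strict Implicit.
Unset Printing Implicit Defensive.

Local Open Scope classical_set_scope.
Local Open Scope ring_scope.

(* Measurable types are pointed in the library, hence pointed metric spaces;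
   a space carrying a probability measure is nonempty anyway. *)
#[short(type="pmetricType")]
HB.structure Definition PointedMetric (K : numDomainType) :=
  {M of Metric K M & isPointed M}.

HB.instance Definition _ (X Y : ptopologicalType) := Pointed.on (X * Y)%type.

Definition borel (X : ptopologicalType) := g_sigma_algebraType (@open X).
HB.instance Definition _ (X : ptopologicalType) := Measurable.on (borel X).

Section WeakConvergence.
Context (R : realType) (X : ptopologicalType).

Definition bounded_continuous : Type :=
  {f : X -> R | continuous f /\ exists C : R, forall z, `|f z| <= C}.

Definition integrate (m : probability (borel X) R) :
    {ptws bounded_continuous -> R} :=
  fun f => \int[m]_z (sval f : borel X -> R) z.

(* The topology of weak convergence: the coarsest one making m |-> \int f dm
   continuous for every bounded continuous f. *)
Definition prob : Type := initial_topology integrate.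
HB.instance Definition _ := Topological.on prob.

End WeakConvergence.

(* The state space {1, ..., D}, nonempty, with D = d.+1, indexed from 0. *)
Definition state (d : nat) : Type := discrete_topology 'I_d.+1.
HB.instance Definition _ d := Finite.copy (state d) 'I_d.+1.
HB.instance Definition _ d := Topological.on (state d).
HB.instance Definition _ d := isPointed.Build (state d) ord0.

Section ControlledRates.
Context (R : realType) (d : nat) (U : Type).
Local Notation S := (state d).
Local Notation vec := 'rV[R]_d.+1.
Implicit Types (x y z : S) (p a b g : vec) (u : U).

Definition orthant : set vec := [set a | forall y : 'I_d.+1, 0 <= a ord0 y].

Definition dotv p a : R := \sum_(y < d.+1) p ord0 y * a ord0 y.

(* Differentiability relative to the closed orthant (including its boundary).
   The norm is the sup norm, which is equivalent to the Euclidean one. *)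
Definition is_gradient (f : vec -> R) a g :=
  (f b - f a - dotv g (b - a)) / `|b - a| @[b --> within orthant a^'] --> (0 : R).

Definition nabla (f : S -> R) x : vec := \row_(y < d.+1) (f y - f x).

(* Only the values of L on the orthant are relevant. *)
Variable L : S -> vec -> U -> R.

Definition cost x p u a : R :=
  \sum_(y : S | y != x) a ord0 y * p ord0 y + L x a u.

Definition hamiltonian x p u : R := - inf [set cost x p u a | a in orthant].

Definition is_minimizer x p u a :=
  orthant a /\ forall b, orthant b -> cost x p u a <= cost x p u b.

(* Under assumption1 the minimizer exists and is unique; 0 is a junk default. *)
Definition astar x p u : vec := xget 0 (is_minimizer x p u).

(* Jump rate from y to x, with the usual convention on the diagonal. *)
Definition rate y p u x : R :=
  if x == y then - \sum_(z : S | z != y) astar y p u ord0 z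
  else astar y p u ord0 x.

End ControlledRates.

Section MeanFieldGame.
Context (R : realType) (d : nat) (U : pmetricType R).
Local Notation S := (state d).
Local Notation vec := 'rV[R]_d.+1.
Local Notation PUS := (prob R (U * S)%type).

Definition assumption1 (L : S -> vec -> U -> R) :=
  exists dL : S -> vec -> U -> vec,
  [/\ forall x a u, orthant a -> is_gradient (L x ^~ u) a (dL x a u),
      forall x a, orthant a -> continuous (L x a),
      forall x a, orthant a -> continuous (dL x a) &
      exists2 gamma : R, 0 < gamma & forall x a a' u, orthant a -> orthant a' ->
        L x a u + dotv (dL x a u) (a' - a)
          + gamma * \sum_(y < d.+1) (a' ord0 y - a ord0 y) ^+ 2 <= L x a' u].

Definition P_mu (mu : probability (borel U) R) : set PUS :=
  [set m : PUS | forall A : set (borel U), measurable A ->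
     (m : probability (borel (U * S)%type) R) (A `*` [set: S]) = mu A].

Definition assumption2 (mu : probability (borel U) R)
    (F : S -> PUS -> U -> R) :=
  (exists C : R, forall x m u, `|F x m u| <= C) /\
  forall x, {within P_mu mu `*` [set: U],
    continuous (fun mu' : PUS * U => F x mu'.1 mu'.2)}.

(* Measurable in u, and a probability vector for every u. *)
Definition prob_vectors (q : S -> U -> R) :=
  [/\ forall x, measurable_fun [set: borel U] (q x : borel U -> R),
      forall x u, 0 <= q x u & forall u, \sum_(x : S) q x u = 1].

(* m(x, du) = q_x(u) mu(du), as measures on U * S. *)
Definition disintegrates (mu : probability (borel U) R) (m : PUS)
    (q : S -> U -> R) :=
  prob_vectors q /\ forall x (A : set (borel U)), measurable A ->
    (m : probability (borel (U * S)%type) R) (A `*` [set x])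
    = (\int[mu]_(u in A) (q x u)%:E)%E.

(* f is differentiable at t relative to [0, T], with derivative l:
   one-sided at the endpoints. *)
Definition has_derivative (T : R) (f : R -> R) (t l : R) :=
  (f s - f t) / (s - t) @[s --> within `[0, T] t^'] --> l.

(* V, m and q are only relevant at times in [0, T]; q t x u is m_x(t, u). *)
Definition mfg_solution (T : R) (mu : probability (borel U) R)
    (L : S -> vec -> U -> R) (F G : S -> PUS -> U -> R) (m0 : S -> U -> R)
    (V : R -> S -> U -> R) (m : R -> PUS) (q : R -> S -> U -> R) :=
  let DV t x u : vec := nabla (fun y => V t y u) x in
  [/\ forall t, t \in `[0, T] -> P_mu mu (m t) /\ disintegrates mu (m t) (q t),
      forall t x u, t \in `[0, T] ->
        exists2 dV, has_derivative T (fun s => V s x u) t dV &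
                    - dV = - hamiltonian L x (DV t x u) u + F x (m t) u,
      forall x u, V T x u = G x (m T) u,
      forall t x u, t \in `[0, T] ->
        has_derivative T (fun s => q s x u) t
          (\sum_(y : S) q t y u * rate L y (DV t y u) u x) &
      forall x u, q 0 x u = m0 x u].

End MeanFieldGame.

(* Main.v *)
Require Import Defs.
From HB Require Import structures.
From mathcomp Require Import all_boot all_order all_algebra.
From mathcomp Require Import ring lra zify.
Import Order.TTheory GRing.Theory Num.Theory.

Set Implicit Arguments.
Unset Strict Implicit.
Unset Printing Implicit Defensive.

(** The system couples a backward Hamilton-Jacobi-Bellman equation with a forward
    Kolmogorov equation, one copy of both for every u, the copies being linked
    only through the law m(t) that enters F and G. A solution is obtained as a
    limit of solutions of a discrete system.

    Time is cut into n steps of length h = T / n, and U into finitely many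
    measurable cells of small diameter. In the explicit Euler scheme the values
    at the grid times, in the states and in the cells determine the optimal
    rates, these determine the transition matrices, hence the laws, and hence F
    and G, from which the values are recomputed. So a solution of the scheme is
    a fixed point of a continuous self-map of a finite-dimensional cube
    ([scheme_exists]), given by Brouwer's theorem ([brouwer_cube]). The values
    are clipped to stay in the cube; the clipping is inactive at the fixed point
    because the scheme is monotone when h times the exit rate is at most 1
    ([backward_step]). Brouwer's theorem itself is deduced from Scarf's
    combinatorial lemma ([exists_rainbow]), whose proof is a parity count.

    All limits are taken along one fixed nonprincipal ultrafilter [om] on nat,
    along which every bounded real sequence converges; it replaces the
    successive extractions of subsequences. Three facts make the passage to the
    limit possible.
    - Strong convexity of L makes the minimizer unique and continuous in (p, u),
      and the Hamiltonian Lipschitz in bounded p ([minimizer_growth],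
      [astar_cvg], [hamiltonian_lipschitz]).
    - The laws with first marginal mu form a compact set: a setwise ultralimit of
      such laws is countably additive because all of them lie below the measure
      that puts a copy of mu on every layer U * {x} ([P_mu_compact]). Therefore F
      and G are uniformly continuous on the laws times U, uniformly in all
      discretizations ([assumption2_uniform]).
    - Consequently, by Gronwall's inequality, values and transition matrices of
      all schemes are Lipschitz in time and equicontinuous in u, up to the mesh
      ([W_equi], [trans_equi]).
    By equicontinuity in u the transition matrices converge uniformly in u to a
    limit that is continuous in u. The limit densities are therefore measurable,
    and the laws converge. By equicontinuity in time, the increments of the grid
    functions are h times the right-hand side up to a small relative error, so
    that the limits are differentiable and solve the equations
    ([limit_derivative]). *)

(** * Scarf's combinatorial lemma *)

Section Scarf.
Variables (X I : finType) (o : I -> X -> nat).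
Hypothesis o_inj : forall i, injective (o i).

(** For points ordered by their coordinates, A is dominant when the simplex cut
    out by the coordinatewise minima over A contains no point of X in its
    interior. *)
Definition dominant (A : {set X}) :=
  [forall y, exists i, forall s in A, o i y <= o i s].

Lemma dominantP (A : {set X}) :
  reflect (forall y, exists i, forall s, s \in A -> o i y <= o i s) (dominant A).
Proof.
apply: (iffP forallP) => H y; have := H y.
  by move=> /existsP[i /forall_inP Hi]; exists i.
by move=> [i Hi]; apply/existsP; exists i; apply/forall_inP.
Qed.

Lemma dominantS (A B : {set X}) : A \subset B -> dominant B -> dominant A.
Proof.
move=> AB /dominantP dB; apply/dominantP => y; have [i Hi] := dB y.
by exists i => s sA; apply: Hi; apply: (subsetP AB).
Qed.

(** Dominant sets of #|I| - 1 elements (doors) and of #|I| elements (rooms) play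
    the part of the walls and of the cells of a triangulation: a door belongs to
    at most two rooms. *)
Section Door.
Variable A : {set X}.
Hypotheses (cA : #|A|.+1 = #|I|) (dA : dominant A) (A0 : A != set0).

Let a0 : X := xchoose (set0Pn _ A0).
Let a0A : a0 \in A. Proof. exact: (xchooseP (set0Pn _ A0)). Qed.

Definition least (i : I) : X := [arg min_(x < a0 in A) o i x].

Lemma leastP i : least i \in A /\ forall s, s \in A -> o i (least i) <= o i s.
Proof. by rewrite /least; case: arg_minnP. Qed.

(** By dominance s lies below all of A in some order, so it is the least element
    of A there. *)
Lemma least_onto s : s \in A -> exists i, least i = s.
Proof.
move=> sA; have [i Hi] := dominantP _ dA s; exists i.
have [lA ll] := leastP i.
by apply: (@o_inj i); apply/eqP; rewrite eqn_leq ll// Hi.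
Qed.

Lemma dominant_least y : exists i, o i y <= o i (least i).
Proof.
by have [i Hi] := dominantP _ dA y; exists i; apply: Hi; have [] := leastP i.
Qed.

(** The points that would break dominance if the order i were dropped. *)
Definition above i : {set X} := [set y | [forall j, (j != i) ==> (o j (least j) < o j y)]].

Lemma aboveP i y :
  reflect (forall j, j != i -> o j (least j) < o j y) (y \in above i).
Proof.
rewrite inE; apply: (iffP forallP) => H j; first by move/(implyP (H j)).
by apply/implyP/H.
Qed.

(** A new point x is least in x |: A for some order i, and for no other one: the
    #|I| elements of x |: A are all least for some order, so each is least for
    exactly one. *)
Lemma room_above x : x \notin A -> dominant (x |: A) ->
  exists i, x \in above i /\ {in A, forall s, exists2 j, j != i & least j = s}.
Proof.
move=> xA /dominantP dx.
have [i Hi] := dx x.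
exists i; split.
  apply/aboveP => j ji; rewrite ltnNge; apply/negP => xj.
  have key : forall s, s \in x |: A -> exists2 k, k != j & forall t, t \in x |: A -> o k s <= o k t.
    move=> s; rewrite inE => /orP[/set1P->|sA]; first by exists i; rewrite 1?eq_sym.
    have [k Hk] := dx s; exists k => //; apply: contraNneq xA => kj; rewrite kj in Hk.
    have := Hk _ (setU11 _ _).
    have [lA ll] := leastP j => sx.
    by rewrite (_ : x = s)//; apply: (@o_inj j); apply/eqP; rewrite eqn_leq sx (leq_trans xj)// ll.
  (* otherwise the #|I| points would be least for orders other than j *)
  pose h s := if pick [pred k | (k != j) && [forall t in x |: A, o k s <= o k t]] is Some k then k else j.
  have hP s : s \in x |: A -> h s != j /\ forall t, t \in x |: A -> o (h s) s <= o (h s) t.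
    move=> /key[k kj Hk]; rewrite /h; case: pickP => [l /=/andP[lj /forall_inP]//|/(_ k)].
    by rewrite /= kj; have -> : [forall t in x |: A, o k s <= o k t] by apply/forall_inP.
  have hinj : {in x |: A &, injective h}.
    move=> s t sA tA hst; have [_ hs] := hP _ sA; have [_ ht] := hP _ tA.
    by apply: (@o_inj (h s)); apply/eqP; rewrite eqn_leq hs// hst ht.
  have := card_in_imset hinj; rewrite cardsU1 xA add1n cA => cI.
  have : h @: (x |: A) = setT by apply/eqP; rewrite eqEcard subsetT cardsT cI leqnn.
  move/setP/(_ j); rewrite in_setT => /imsetP[s sA js].
  by have [] := hP _ sA; rewrite -js eqxx.
move=> s sA; have [j Hj] := dx s; exists j.
  apply: contraNneq xA => ji; rewrite ji in Hj.
  have h1 := Hi _ (setU1r _ sA); have h2 := Hj _ (setU11 _ _).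
  by rewrite (_ : x = s)//; apply: (@o_inj i); apply/eqP; rewrite eqn_leq h1 h2.
have [lA ll] := leastP j.
by apply: (@o_inj j); apply/eqP; rewrite eqn_leq ll// Hj// setU1r.
Qed.

(** The map i |-> least i sends #|I| orders onto #|I| - 1 points, so exactly two
    orders share their least element. *)
Lemma least_collision : exists i1 i2, [/\ i1 != i2, least i1 = least i2 &
  forall i, {in A, forall s, exists2 j, j != i & least j = s} <-> i \in [:: i1; i2]].
Proof.
have imA : least @: setT = A.
  apply/setP => s; apply/imsetP/idP => [[i _ ->]|/least_onto[i <-]]; last by exists i.
  by have [] := leastP i.
have /injectivePn [i1 [i2 i12 e12]] : ~~ injectiveb least.
  apply/negP => /injectiveP inj; have := card_imset setT inj.
  by rewrite imA cardsT -cA => /eqP; rewrite ltn_eqF.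
exists i1, i2; split=> // i; rewrite !inE; split.
  move=> Hi; apply/negP => /negP; rewrite negb_or => /andP[ni1 ni2].
  have sub : A \subset least @: ([set~ i] :\ i2).
    apply/subsetP => s /Hi[j ji js]; have [ji2|ji2] := eqVneq j i2.
      apply/imsetP; exists i1; last by rewrite e12 -js ji2.
      by rewrite !inE i12 eq_sym ni1.
    by apply/imsetP; exists j; rewrite ?js// !inE ji ji2.
  have le := leq_trans (subset_leq_card sub) (leq_imset_card _ _).
  have := cardsD1 i2 [set~ i]; rewrite !inE eq_sym ni2 add1n cardsC1 -cA /= => e.
  suff : #|A| < #|A| by rewrite ltnn.
  by rewrite {2}e ltnS.
move=> ii s /least_onto[j <-]; have [ji|ji] := eqVneq j i; last by exists j.
by case/orP: ii => /eqP ii; [exists i2|exists i1]; rewrite ?ji ii ?e12// 1?eq_sym.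
Qed.

(** The extending point is the highest element of [above i] in the order i: a
    lower one would leave the highest one undominated. *)
Lemma extension_at i : {in A, forall s, exists2 j, j != i & least j = s} ->
  above i != set0 -> exists x, forall y,
    [&& y \notin A, dominant (y |: A) & y \in above i] = (y == x).
Proof.
move=> onto /set0Pn[z zi].
pose x := [arg max_(x > z in above i) o i x].
have [xi xmax] : x \in above i /\ forall y, y \in above i -> o i y <= o i x.
  by rewrite /x; case: arg_maxnP.
have le_x : o i x <= o i (least i).
  have [j] := dominant_least x; have [->//|ji] := eqVneq j i.
  by move/aboveP: xi => /(_ _ ji); rewrite ltnNge => /negbTE->.
exists x => y; apply/idP/eqP => [/and3P[yA /dominantP dy yi]|->].
  have [j Hj] := dy x; have [ji|ji] := eqVneq j i; last first.
    have := Hj _ (setU1r _ (proj1 (leastP j))).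
    by move/aboveP: xi => /(_ _ ji); rewrite ltnNge => /negbTE->.
  rewrite ji in Hj; apply: (@o_inj i); apply/eqP.
  by rewrite eqn_leq xmax// Hj// setU11.
have xA : x \notin A.
  apply/negP => /onto[j ji jx]; move/aboveP: xi => /(_ _ ji).
  by rewrite jx ltnn.
rewrite xA xi andbT; apply/dominantP => w.
have [wi|wi] := boolP (w \in above i).
  exists i => s; rewrite inE => /orP[/set1P->|sA]; first exact: xmax.
  by rewrite (leq_trans (xmax _ wi))// (leq_trans le_x)//; apply: (proj2 (leastP i)).
have [j ji wj] : exists2 j, j != i & o j w <= o j (least j).
  move: wi; rewrite inE negb_forall => /existsP[j].
  by rewrite negb_imply -leqNgt => /andP[]; exists j.
exists j => s; rewrite inE => /orP[/set1P->|sA].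
  by rewrite (leq_trans wj)// ltnW//; move/aboveP: xi; apply.
by rewrite (leq_trans wj)//; apply: (proj2 (leastP j)).
Qed.

Lemma above_disjoint i j x : i != j -> x \in above i -> x \in above j -> False.
Proof.
move=> ij /aboveP xi /aboveP xj; have [k] := dominant_least x.
by have [->|ki] := eqVneq k i; rewrite leqNgt; [rewrite xj|rewrite xi].
Qed.

Definition extensions : {set X} := [set x | (x \notin A) && dominant (x |: A)].

Lemma card_extensions : exists i1 i2, i1 != i2 /\
  #|extensions| = (above i1 != set0) + (above i2 != set0).
Proof.
have [i1 [i2 [i12 _ Hi]]] := least_collision; exists i1, i2; split => //.
have E : extensions = (extensions :&: above i1) :|: (extensions :&: above i2).
  apply/setP => x; rewrite -setIUr !inE; apply/idP/idP => [|/andP[]//].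
  move=> /[dup] xe /andP[xA dx]; rewrite xe /=.
  have [i [xi /Hi]] := room_above xA dx; rewrite !inE => /orP[]/eqP ii; rewrite ii in xi.
    by move: xi; rewrite inE => ->.
  by move: xi; rewrite inE => ->; rewrite orbT.
have cardi i : i \in [:: i1; i2] -> #|extensions :&: above i| = (above i != set0).
  move=> /Hi onto; case: eqVneq => [->|ne]; first by rewrite setI0 cards0.
  have [x Hx] := extension_at onto ne; rewrite (_ : _ :&: _ = [set x]) ?cards1//.
  by apply/setP => y; rewrite in_setI [y \in extensions]inE -andbA Hx inE.
have disj : (extensions :&: above i1) :&: (extensions :&: above i2) = set0.
  apply/setP => x; rewrite !inE; apply/negP => /andP[/andP[_ h1] /andP[_ h2]].
  by apply: (above_disjoint i12 (x := x)); rewrite inE.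
by rewrite {1}E cardsU disj cards0 subn0 !cardi ?inE ?eqxx ?orbT.
Qed.

End Door.

Section Parity.
Variables (c : X -> I) (e : I -> X) (i0 : I).

(** If removing s leaves all colours but i0, the colour of s occurs exactly once
    more, at t, and removing t is the only other possibility. *)
Lemma even_typed_faces (B : {set X}) : #|B| = #|I| -> c @: B != setT ->
  ~~ odd #|[set s in B | c @: (B :\ s) == [set~ i0]]|.
Proof.
move=> cB ncB; set K := [set _ in _ | _].
have [->|/set0Pn[s]] := eqVneq K set0; first by rewrite cards0.
rewrite !inE => /andP[sB /eqP cs].
have cBs : #|c @: (B :\ s)| = #|B :\ s|.
  by rewrite cs cardsC1 -cB (cardsD1 s B) sB.
have inj := imset_injP (introT eqP cBs).
have csi0 : c s != i0.
  apply: contraNneq ncB => ci; rewrite -(setD1K sB) imsetU1 cs ci.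
  by apply/eqP/setP => i; rewrite !inE; case: eqP.
have /imsetP[t tBs cst] : c s \in c @: (B :\ s) by rewrite cs !inE.
have /setD1P[ts tB] := tBs.
have cBE : c @: B = [set~ i0] by rewrite -(setD1K sB) imsetU1 cs cst -cs (setUidPr _)// sub1set imset_f.
suff -> : K = [set s; t] by rewrite cards2 eq_sym ts.
apply/setP => r; rewrite !inE; apply/andP/orP => [[rB /eqP cr]|].
  have [->|rs] := eqVneq r s; first by left.
  right; have rBs : r \in B :\ s by rewrite !inE rs.
  have : c r \in c @: (B :\ r) by rewrite cr -cBE imset_f.
  case/imsetP => v /setD1P[vr vB] crv.
  have vs : v = s.
    apply/eqP; apply: contraNT vr => vs; apply/eqP; apply: inj => //.
    by rewrite !inE vs.
  by rewrite vs cst in crv; apply/eqP/inj.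
case=> /eqP ->; first by rewrite sB cs.
rewrite tB; split=> //; rewrite -cBE eqEsubset imsetS ?subsetDl//=.
apply/subsetP => i /imsetP[v vB ->]; have [->|vt] := eqVneq v t.
  by rewrite -cst imset_f// !inE eq_sym ts sB.
by rewrite imset_f// !inE vt.
Qed.

(* The dummy e i stands for the face where the i-th coordinate vanishes: it is
   the lowest point in the order i, and above all real points in the others. *)
Hypotheses (ce : cancel e c)
  (low : forall i x, x != e i -> o i (e i) < o i x)
  (high : forall i j x, j != i -> x \notin codom e -> o j x < o j (e i)).
Variable x0 : X.
Hypothesis x0e : x0 \notin codom e.

Let doors := [set A : {set X} | [&& #|A|.+1 == #|I|, dominant A & c @: A == [set~ i0]]].
Let corner := e @: [set~ i0].

Lemma not_dummy i x : x \notin codom e -> x != e i.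
Proof. by apply: contraNneq => ->; apply: codom_f. Qed.

(** The door made of all dummies but e i0 lies on the boundary: its only room
    adds the real point that is highest in the order i0. *)
Lemma card_corner_extensions : #|extensions corner| = 1.
Proof.
pose x := [arg max_(x > x0 | x \notin codom e) o i0 x].
have [xe xmax] : x \notin codom e /\ forall y, y \notin codom e -> o i0 y <= o i0 x.
  by rewrite /x; case: arg_maxnP.
suff -> : extensions corner = [set x] by rewrite cards1.
apply/setP => z; rewrite !inE; apply/andP/eqP => [[zc /dominantP dz]|->].
  have real_min y : y \notin codom e -> o i0 y <= o i0 z.
    move=> ye; have [i Hi] := dz y; have [ii|ii] := eqVneq i i0.
      by rewrite -ii Hi// setU11.
    have : e i \in z |: corner by rewrite setU1r// imset_f// !inE.
    by move/Hi; rewrite leqNgt low// not_dummy.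
  have ze : z \notin codom e.
    apply: contra zc => /codomP[i zi]; rewrite zi imset_f// !inE.
    apply: contraTneq (real_min _ x0e) => ii.
    by rewrite zi ii -ltnNge low// not_dummy.
  by apply: (@o_inj i0); apply/eqP; rewrite eqn_leq xmax// real_min.
split; first by apply: contra xe => /imsetP[i _ ->]; apply: codom_f.
apply/dominantP => y; have [/codomP[k ->]|ye] := boolP (y \in codom e).
  by exists k => s _; have [->//|sk] := eqVneq s (e k); apply/ltnW/low.
exists i0 => s /setU1P[->|/imsetP[j]]; first exact: xmax.
by rewrite !inE => ji ->; apply/ltnW/high; rewrite 1?eq_sym.
Qed.

Lemma cornerP A : A \in doors -> A \subset codom e -> A = corner.
Proof.
rewrite inE => /and3P[/eqP cA _ /eqP cAi] /subsetP Ae.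
apply/eqP; rewrite eqEcard; apply/andP; split.
  apply/subsetP => s sA; have /codomP[i si] := Ae _ sA.
  have : c s \in c @: A by rewrite imset_f.
  by rewrite cAi si ce => ?; rewrite imset_f.
by rewrite card_imset ?cardsC1 -?cA//; exact: can_inj ce.
Qed.

Lemma corner_door : corner \in doors.
Proof.
rewrite inE card_imset ?cardsC1; last exact: can_inj ce.
rewrite prednK ?eqxx/=; last by apply/card_gt0P; exists i0.
apply/andP; split; last first.
  rewrite -imset_comp; apply/eqP/setP => i; rewrite !inE.
  apply/imsetP/idP => [[j ji ->]|ii]; first by rewrite /= ce !inE in ji *.
  by exists i; rewrite ?inE//= ce.
have : extensions corner != set0 by rewrite -card_gt0 card_corner_extensions.
case/set0Pn => x; rewrite inE => /andP[_]; apply: dominantS.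
by apply/subsetP => s; apply: setU1r.
Qed.

(** A real point of A lies below each dummy e i in all orders but i. So no set
    [above i] is empty, and A has two extensions. *)
Lemma even_extensions A : A \in doors -> A != corner -> ~~ odd #|extensions A|.
Proof.
move=> Ad Ac.
have /subsetPn[r rA re] : ~~ (A \subset codom e) by apply: contra Ac => /(cornerP Ad) ->.
have A0 : A != set0 by apply/set0Pn; exists r.
move: Ad; rewrite inE => /and3P[/eqP cA dA _].
have [i1 [i2 [_ ->]]] := card_extensions cA dA A0.
have all_above i : above A0 i != set0.
  apply/set0Pn; exists (e i); apply/aboveP => j ji.
  by apply: leq_ltn_trans (high ji re); apply: (proj2 (leastP A0 j)).
by rewrite !all_above.
Qed.

(** Count the pairs of a door with all colours but i0 and a room containing it:
    each such door has two rooms, except the corner, which has one, and each room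
    that misses a colour has an even number of such doors. So some room has all
    the colours. *)
Lemma exists_rainbow : exists B : {set X},
  [/\ #|B| = #|I|, dominant B & c @: B = setT].
Proof.
pose rooms := [set B : {set X} | (#|B| == #|I|) && dominant B].
pose faces (B : {set X}) := [set s in B | c @: (B :\ s) == [set~ i0]].
have double_count : \sum_(A in doors) #|extensions A| = \sum_(B in rooms) #|faces B|.
  under eq_bigr do rewrite -sum1_card; under [RHS]eq_bigr do rewrite -sum1_card.
  rewrite (exchange_big_dep predT)//= [RHS](exchange_big_dep predT)//=.
  apply: eq_bigr => x _.
  rewrite (reindex_onto (fun B : {set X} => B :\ x) (fun A => x |: A)) /=; last first.
    by move=> A /andP[_]; rewrite inE => /andP[xA _]; apply: setU1K.
  apply: eq_bigl => B; rewrite !inE eqxx /=.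
  have [xB|xB] := boolP (x \in B); last first.
    have -> : (x |: B :\ x == B) = false.
      by apply: contraNF xB => /eqP <-; rewrite setU11.
    by rewrite /= !andbF.
  rewrite setD1K// eqxx andbT (cardsD1 x B) xB add1n.
  by case: (dominant B) /(@idP (dominant B)) => dB; rewrite ?andbF//= ?andbT
    (dominantS (subD1set B x) dB).
have odd_sum : odd (\sum_(A in doors) #|extensions A|).
  rewrite (bigD1 corner) ?corner_door//= card_corner_extensions oddD /=.
  apply: (big_ind (fun n => ~~ odd n)) => // [m n|A /andP[]]; last exact: even_extensions.
  by rewrite oddD => /negbTE-> /negbTE->.
have [/existsP[B /and3P[/eqP cB dB /eqP]]|] :=
    boolP [exists B : {set X}, [&& #|B| == #|I|, dominant B & c @: B == setT]].
  by exists B.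
rewrite negb_exists => /forallP none; move: odd_sum; rewrite double_count.
have : ~~ odd (\sum_(B in rooms) #|faces B|); last by move/negbTE->.
apply: (big_ind (fun n => ~~ odd n)) => // [m n|B].
  by rewrite oddD => /negbTE-> /negbTE->.
rewrite inE => /andP[/eqP cB dB]; apply: even_typed_faces => //.
by have := none B; rewrite cB eqxx dB.
Qed.

End Parity.
End Scarf.

(** * Grid points of a simplex *)

Section Grid.
Variables (I : finType) (n : nat).
Local Open Scope nat_scope.

Definition grid : finType := {g : {ffun I -> 'I_n.+1} | \sum_i g i == n}.
Definition grid_val (g : grid) i : nat := val g i.

Lemma grid_sum (g : grid) : \sum_i grid_val g i = n.
Proof. exact/eqP/(valP g). Qed.

Lemma grid_of (h : I -> nat) : \sum_i h i = n -> exists g : grid, forall i, grid_val g i = h i.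
Proof.
move=> hn.
have hle i : h i <= n by rewrite -hn (bigD1 i)//= leq_addr.
have hv i : (inord (h i) : 'I_n.+1) = h i :> nat by rewrite inordK// ltnS.
pose g : {ffun I -> 'I_n.+1} := [ffun i => inord (h i)].
have gP : \sum_i g i == n.
  by apply/eqP; rewrite -[RHS]hn; apply: eq_bigr => i _; rewrite ffunE.
exists (exist _ g gP) => i.
by rewrite /grid_val /= ffunE.
Qed.

(** The grid points are ordered by their i-th coordinate, ties being broken by
    their rank; the dummy i comes first and the other dummies come last. *)
Definition grid_order i (x : grid + I) : nat :=
  match x with
  | inl g => (grid_val g i * #|grid| + enum_rank g).+1
  | inr j => if j == i then 0 else (n.+1 * #|grid| + enum_rank j).+1
  end.

Lemma grid_order_lt g i : (grid_val g i * #|grid| + enum_rank g) < n.+1 * #|grid|.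
Proof.
have h : grid_val g i <= n by rewrite -(grid_sum g) (bigD1 i)//= leq_addr.
have := ltn_ord (enum_rank g); rewrite mulSn addnC -(leq_add2r (grid_val g i * #|grid|)).
by move/leq_trans; apply; rewrite leq_add2l leq_mul2r h orbT.
Qed.

Lemma grid_order_inj i : injective (grid_order i).
Proof.
have M0 (g : grid) : 0 < #|grid| by apply/card_gt0P; exists g.
move=> [g|j] [g'|j'] /=.
- move=> [] e; congr inl; apply: enum_rank_inj; apply: val_inj => /=.
  have := congr1 (modn^~ #|grid|) e.
  by rewrite !modnMDl !modn_small.
- by case: eqP => // _ [] e; have := grid_order_lt g i; rewrite e ltnNge leq_addr.
- by case: eqP => // _ [] e; have := grid_order_lt g' i; rewrite -e ltnNge leq_addr.
- case: eqP => [->|_]; case: eqP => [->//|_] //= [] /addnI e.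
  by congr inr; apply/enum_rank_inj/val_inj.
Qed.

Lemma grid_order_le i g g' :
  grid_order i (inl g) <= grid_order i (inl g') -> grid_val g i <= grid_val g' i.
Proof.
rewrite /= ltnS => h; rewrite leqNgt; apply/negP => lt.
have : grid_val g' i * #|grid| + enum_rank g' < grid_val g i * #|grid| + enum_rank g.
  apply: leq_trans (leq_addr _ _).
  apply: (@leq_trans ((grid_val g' i).+1 * #|grid|)); last by rewrite leq_mul2r lt orbT.
  by rewrite mulSn addnC ltn_add2r.
by rewrite ltnNge h.
Qed.

(** Let J be the set of those i whose dummy is not in the rainbow set B, and m i
    the minimum of the i-th coordinate over the grid points of B. Dominance
    forbids a grid point with coordinates at least m i + 1 for i in J, so these
    numbers add up to more than n. As the coordinates of every grid point of B
    add up to n, they exceed m i by at most #|I| on J, and are at most #|I|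
    outside J. *)
Lemma rainbow_grid (i0 : I) (c : grid -> I) : exists p : I -> grid,
  (forall i j k, grid_val (p i) k <= grid_val (p j) k + #|I|) /\
  forall i, c (p i) = i \/ grid_val (p i) i <= #|I|.
Proof.
pose cx (x : grid + I) := match x with inl g => c g | inr i => i end.
have [g0 g0E] : exists g : grid, forall i, grid_val g i = (i == i0) * n.
  by apply: grid_of; rewrite (bigD1 i0)//= eqxx mul1n big1 ?addn0// => i /negbTE->.
have real g : (inl g : grid + I) \notin codom (@inr grid I).
  by apply/negP => /codomP[].
have [] := @exists_rainbow _ _ _ grid_order_inj cx (@inr grid I) i0 _ _ _ (inl g0) (real _).
- by [].
- move=> i [g|j] /=; rewrite eqxx// => ji.
  by case: eqP => [e|//]; rewrite e eqxx in ji.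
- move=> i j [g|k] ji /=; last by rewrite codom_f.
  move=> _; rewrite eq_sym (negbTE ji) ltnS.
  by apply: leq_trans (grid_order_lt _ _) (leq_addr _ _).
move=> B [cB /dominantP dB rB].
pose J := [set i | inr i \notin B].
have domJ y : exists2 i, i \in J & forall g, inl g \in B -> grid_val y i <= grid_val g i.
  have [i Hi] := dB (inl y); exists i.
    by rewrite inE; apply/negP => /Hi /=; rewrite eqxx.
  by move=> g /Hi; apply: grid_order_le.
have [g1 g1B] : exists g, inl g \in B.
  have [i] := domJ g0; rewrite inE => iB _.
  have : i \in cx @: B by rewrite rB inE.
  by case/imsetP => [[g|j]] gB /= ij; [exists g|rewrite ij gB in iB].
pose gm i := [arg min_(g < g1 | inl g \in B) grid_val g i].
pose m i := grid_val (gm i) i.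
have gmP i : inl (gm i) \in B /\ forall g, inl g \in B -> m i <= grid_val g i.
  by rewrite /m /gm; case: arg_minnP.
have mle g i : inl g \in B -> m i <= grid_val g i by apply: (proj2 (gmP i)).
have minm y i : (forall g, inl g \in B -> y <= grid_val g i) -> y <= m i.
  by apply; have [] := gmP i.
have [j0 j0J _] := domJ g0.
have summ : n < \sum_(i in J) (m i).+1.
  rewrite ltnNge; apply/negP => le.
  pose h i := if i \in J then (m i).+1 + (if i == j0 then n - \sum_(i in J) (m i).+1 else 0) else 0.
  have [y yE] : exists g : grid, forall i, grid_val g i = h i.
    apply: grid_of; rewrite (bigID (mem J))/= [X in _ + X]big1 ?addn0; last first.
      by move=> i; rewrite /h => /negbTE ->.
    transitivity (\sum_(i in J) ((m i).+1 + (if i == j0 then n - \sum_(i in J) (m i).+1 else 0))).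
      by apply: eq_bigr => i iJ; rewrite /h iJ.
    rewrite big_split/= [X in _ + X](bigD1 j0)//= eqxx [X in _ + (_ + X)]big1; last first.
      by move=> i /andP[_ /negbTE->].
    by rewrite addn0 subnKC.
  have [i iJ Hi] := domJ y.
  have : (m i).+1 <= m i.
    by apply: minm => g gB; apply: leq_trans (Hi _ gB); rewrite yE /h iJ leq_addr.
  by rewrite ltnn.
have sumJ g : inl g \in B -> \sum_(i in J) grid_val g i < \sum_(i in J) m i + #|I|.
  move=> gB; apply: (@leq_ltn_trans n).
    by rewrite -[X in _ <= X](grid_sum g) [X in _ <= X](bigID (mem J))/= leq_addr.
  apply: leq_trans summ _; under eq_bigr do rewrite -addn1.
  by rewrite big_split/= sum1_card leq_add2l max_card.
have inJ g i : inl g \in B -> i \in J -> grid_val g i <= m i + #|I|.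
  move=> gB iJ; have := sumJ _ gB; rewrite (bigD1 i)//= [X in _ < X + _](bigD1 i)//=.
  set a := \sum_(_ in _ | _) _; set b := \sum_(_ in _ | _) _.
  have : b <= a by apply: leq_sum => k _; apply: mle.
  lia.
have outJ g i : inl g \in B -> i \notin J -> grid_val g i <= #|I|.
  move=> gB iJ.
  have le : \sum_(k in J) m k + grid_val g i <= n.
    rewrite -(grid_sum g) [X in _ <= X](bigID (mem J))/= leq_add//.
      by apply: leq_sum => k _; apply: mle.
    by rewrite (bigD1 i)//= leq_addr.
  have lt : \sum_(k in J) m k + #|J| > n.
    by apply: leq_trans summ _; under eq_bigr do rewrite -addn1; rewrite big_split/= sum1_card.
  rewrite -(leq_add2l (\sum_(k in J) m k)); apply: leq_trans le _.
  by apply: leq_trans (ltnW lt) _; rewrite leq_add2l max_card.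
have pP i : exists g, inl g \in B /\ (c g = i \/ grid_val g i <= #|I|).
  have [iJ|iJ] := boolP (i \in J); last by exists g1; split=> //; right; apply: outJ.
  have : i \in cx @: B by rewrite rB inE.
  move: iJ; rewrite inE => iB.
  case/imsetP => [[g|j]] gB /= ij; last by rewrite ij gB in iB.
  by exists g; split=> //; left.
have [p Hp] := fin_all_exists pP.
exists p; split=> [i j k|i]; last by have [] := Hp i.
have [pi _] := Hp i; have [pj _] := Hp j.
have [kJ|kJ] := boolP (k \in J).
  by apply: leq_trans (inJ _ _ pi kJ) _; rewrite leq_add2r mle.
by apply: leq_trans (outJ _ _ pi kJ) (leq_addl _ _).
Qed.

End Grid.

From mathcomp Require Import all_classical all_reals all_analysis.
From mathcomp Require Import measurable_realfun.
Import numFieldNormedType.Exports.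

Local Open Scope classical_set_scope.
Local Open Scope ring_scope.

(** * Limits along an ultrafilter *)

Lemma ultra_ex : exists G : set_system nat, UltraFilter G /\ \oo `<=` G.
Proof. exact: ultraFilterLemma. Qed.

(** A nonprincipal ultrafilter on nat, fixed once and for all. *)
Definition om : set_system nat := sval (cid ultra_ex).

#[global] Instance om_ultra : UltraFilter om.
Proof. exact: (proj1 (svalP (cid ultra_ex))). Qed.

Lemma om_oo : \oo `<=` om.
Proof. exact: (proj2 (svalP (cid ultra_ex))). Qed.

#[global] Instance om_filter : Filter om.
Proof. exact: filter_filter. Qed.

Section UltraLimits.
Context {R : realType}.
Implicit Types (u v : nat -> R) (l : R).

Lemma om_cvg (X : topologicalType) (u : nat -> X) (l : X) : u @ \oo --> l -> u @ om --> l.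
Proof. by move=> ul; apply: cvg_trans ul; apply: cvg_app; apply: om_oo. Qed.

Lemma om_compact (X : topologicalType) (A : set X) (u : nat -> X) :
  compact A -> (forall n, A (u n)) -> exists2 l, A l & u @ om --> l.
Proof.
move=> cA Au; have := cA (u @ om) _ _.
case=> [|p [Ap]]; first by rewrite nbhs_simpl /= /fmap/=; apply: filterS filterT => n _; apply: Au.
move=> clp; exists p => // B Bp.
have [//|nB] := in_ultra_setVsetC (u @^-1` B) om_ultra.
have [x [Bx nBx]] := clp _ _ (nB : (u @ om) (~` B)) Bp.
by [].
Qed.

Lemma om_bounded u C : (forall n, `|u n| <= C) -> exists l : R, `|l| <= C /\ u @ om --> l.
Proof.
move=> uC; have [n|l lC ul] := om_compact (@segment_compact R (- C) C) (u := u).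
  by rewrite /= in_itv /= -ler_norml.
by exists l; split=> //; move: lC; rewrite /= in_itv /= -ler_norml.
Qed.

Lemma om_le u v l l' : u @ om --> l -> v @ om --> l' -> (forall n, u n <= v n) -> l <= l'.
Proof. by move=> ul vl uv; apply: ler_cvg_to ul vl _; apply: nearW. Qed.

Lemma om_unique u l l' : u @ om --> l -> u @ om --> l' -> l = l'.
Proof. exact: cvg_unique. Qed.

Lemma om_dist u l : u @ om --> l <-> forall e : R, 0 < e -> \forall n \near om, `|u n - l| <= e.
Proof.
split=> [ul e e0|H]; first by near do rewrite distrC; move/cvgrPdist_le : ul; apply.
apply/cvgrPdist_le => e e0; near do rewrite distrC; exact: H.
Unshelve. all: by end_near. Qed.

Lemma om_sum (I : Type) (r : seq I) (P : pred I) (u : nat -> I -> R) (l : I -> R) :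
  (forall i, P i -> u n i @[n --> om] --> l i) ->
  \sum_(i <- r | P i) u n i @[n --> om] --> \sum_(i <- r | P i) l i.
Proof.
move=> ul; elim: r => [|i r IH].
  by under eq_fun do rewrite big_nil; rewrite big_nil; apply: cvg_cst.
under eq_fun do rewrite big_cons; rewrite big_cons.
by case: ifP => // Pi; apply: cvgD => //; apply: ul.
Qed.

Lemma om_squeeze0 u v l : (forall n, `|u n - l| <= v n) -> v @ om --> (0 : R) -> u @ om --> l.
Proof.
move=> uv v0; apply/om_dist => e e0.
have /om_dist/(_ e e0) := v0; apply: filterS => n; rewrite subr0 => ve.
by apply: le_trans (uv n) (le_trans _ ve); apply: ler_norm.
Qed.

Lemma om_harmonic : (n.+1%:R^-1 : R) @[n --> om] --> (0 : R).
Proof. by apply: om_cvg; apply: cvg_harmonic. Qed.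

End UltraLimits.

(** * Brouwer's fixed point theorem *)

Section Brouwer.
Context {R : realType}.

Definition simplex (I : finType) : set (I -> R) :=
  [set v | (forall i, 0 <= v i) /\ \sum_i v i = 1].

(** A form of continuity on A that is implied by the topological one and suffices
    for Brouwer's theorem, in whose proof only limits along om are taken. *)
Definition om_continuous (I J : Type) (A : set (I -> R)) (f : (I -> R) -> (J -> R)) :=
  forall (v : nat -> I -> R) w, (forall n, A (v n)) -> A w ->
    (forall i, v n i @[n --> om] --> w i) ->
    forall j, f (v n) j @[n --> om] --> f w j.

Section Simplex.
Variables (I : finType) (i0 : I) (f : (I -> R) -> (I -> R)).
Hypothesis fS : forall v, simplex v -> simplex (f v).

(** Colour a grid point g of the simplex by an i such that f does not decrease
    its i-th coordinate; such an i exists because g and f g have the same sum. A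
    coordinate of size O(1/n) is almost not decreased either. *)
Lemma almost_fixed (n : nat) : exists p : I -> I -> R,
  [/\ forall i, simplex (p i),
      forall i j k, p i k <= p j k + #|I|%:R / n.+1%:R &
      forall i, p i i - #|I|%:R / n.+1%:R <= f (p i) i].
Proof.
pose pt (g : grid I n.+1) (i : I) : R := (grid_val g i)%:R / n.+1%:R.
have ptS g : simplex (pt g).
  split=> [i|]; first by rewrite /pt divr_ge0.
  by rewrite -mulr_suml -natr_sum grid_sum divff.
have colour g : exists i, pt g i <= f (pt g) i.
  apply: contrapT => /forallNP none.
  have [_ s1] := ptS g; have [_ s2] := fS (ptS g).
  have : \sum_i f (pt g) i < \sum_i pt g i.
    apply: ltr_sum => [|i _]; first by apply/hasP; exists i0; rewrite ?mem_index_enum.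
    by rewrite ltNge; apply/negP/none.
  by rewrite s1 s2 ltxx.
have [c Hc] := choice colour.
have [p [p1 p2]] := rainbow_grid i0 c.
exists (fun i => pt (p i)); split=> [i|i j k|i]; first exact: ptS.
  by rewrite /pt -mulrDl ler_pM2r ?invr_gt0// -natrD ler_nat.
have [ci|le] := p2 i; last first.
  apply: (@le_trans _ _ 0); last by case: (fS (ptS (p i))).
  by rewrite subr_le0 ler_pM2r ?invr_gt0// ler_nat.
by have := Hc (p i); rewrite ci lerBlDr => /le_trans; apply; rewrite lerDl divr_ge0.
Qed.

(** The points of [almost_fixed] have a common limit v with v i <= f v i for all
    i, and both sides add up to 1. *)
Lemma brouwer_simplex : om_continuous (@simplex I) f ->
  exists2 v, simplex v & forall i, f v i = v i.
Proof.
move=> fc; have [p Hp] := choice almost_fixed.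
have dn : (#|I|%:R / n.+1%:R : R) @[n --> om] --> (0 : R).
  by rewrite -(mulr0 #|I|%:R); apply: cvgM; [exact: cvg_cst|exact: om_harmonic].
have bound n i k : `|p n i k| <= 1.
  have [/(_ i)[ge0 s1] _ _] := Hp n; rewrite ger0_norm// -s1 (bigD1 k)//= lerDl.
  by apply: sumr_ge0 => j _; apply: ge0.
have [w Hw] := choice (fun k => om_bounded (fun n => bound n i0 k)).
have {}Hw k := (Hw k).2.
have pw i k : p n i k @[n --> om] --> w k.
  apply/om_dist => e e0.
  have e2 : 0 < e / 2 by rewrite divr_gt0.
  have /om_dist/(_ _ e2) := Hw k; have /om_dist/(_ _ e2) := dn.
  apply: filterS2 => n; rewrite subr0 ger0_norm ?divr_ge0// => d1 d2.
  have [_ near _] := Hp n.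
  rewrite (_ : _ - _ = (p n i k - p n i0 k) + (p n i0 k - w k)); last by ring.
  rewrite (le_trans (ler_normD _ _))// (splitr e) lerD// (le_trans _ d1)//.
  by rewrite ler_norml lerBlDl near andbT lerNl opprB lerBlDl near.
have wS : simplex w.
  split=> [k|].
    apply: (om_le (u := cst 0)) (Hw k) _; first exact: cvg_cst.
    by move=> n; have [/(_ i0)[]] := Hp n.
  apply: (@om_unique _ (fun n => \sum_k p n i0 k)); first exact: om_sum.
  have -> : (fun n => \sum_k p n i0 k) = cst 1.
    by apply/funext => n; have [/(_ i0)[]] := Hp n.
  exact: cvg_cst.
have le i : w i <= f w i.
  have fp : f (p n i) i @[n --> om] --> f w i.
    by apply: (fc (fun n => p n i)) => // n; have [] := Hp n.
  have lo : p n i i - #|I|%:R / n.+1%:R @[n --> om] --> w i - 0 by apply: cvgB.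
  rewrite -[w i]subr0; apply: om_le lo fp _ => n.
  by have [] := Hp n.
exists w => // i; apply/eqP; rewrite eq_le le andbT.
have [_ s1] := wS; have [_ s2] := fS wS.
have : \sum_j (f w j - w j) = 0 by rewrite sumrB s1 s2 subrr.
move/eqP; rewrite psumr_eq0; last by move=> j _; rewrite subr_ge0.
by move/allP/(_ i); rewrite mem_index_enum => /(_ isT); rewrite subr_eq0 => /eqP ->.
Qed.

End Simplex.

Definition clip (C x : R) : R := Num.max (- C) (Num.min C x).

Lemma clip_bound C x : 0 <= C -> `|clip C x| <= C.
Proof. by move=> C0; rewrite /clip ler_norml; case: (ltP C x) => ?; case: (ltP (- C)) => ?; lra. Qed.

Lemma clip_id C x : `|x| <= C -> clip C x = x.
Proof. by rewrite /clip ler_norml; case: (ltP C x) => ?; case: (ltP (- C)) => ?; lra. Qed.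

Lemma clip_lipschitz C x y : `|clip C x - clip C y| <= `|x - y|.
Proof.
rewrite /clip ler_norml; have := ler_norm (x - y); have := ler_norm (- (x - y)).
rewrite normrN.
rewrite !maxElt !minElt.
by case: (ltP C x) => ?; case: (ltP C y) => ?; do 2?case: (ltP (- C) _) => ?;
  move=> ? ?; apply/andP; split; lra.
Qed.

Lemma om_clip C (u : nat -> R) l : u @ om --> l -> clip C (u n) @[n --> om] --> clip C l.
Proof.
move=> ul; apply/om_dist => e e0; have /om_dist/(_ e e0) := ul.
by apply: filterS => n; apply: le_trans (clip_lipschitz _ _ _).
Qed.

(** A point v of the cube is coded by the point of the simplex whose
    coordinates are proportional to v i + C, the slack coordinate taking the
    remaining mass. *)
Lemma brouwer_cube (I : finType) (C : R) (f : (I -> R) -> (I -> R)) : 0 < C ->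
  let cube := [set v : I -> R | forall i, `|v i| <= C] in
  (forall v, cube v -> cube (f v)) -> om_continuous cube f ->
  exists2 v, cube v & forall i, f v i = v i.
Proof.
move=> C0 cube fC fc; pose K : R := 2 * C * #|I|.+1%:R.
have K0 : 0 < K by rewrite !mulr_gt0// ltr0n.
pose emb (v : I -> R) (o : option I) : R :=
  if o is Some i then (v i + C) / K else 1 - \sum_i (v i + C) / K.
pose ret (y : option I -> R) i : R := clip C (K * y (Some i) - C).
have retC y : cube (ret y) by move=> i; apply/clip_bound/ltW.
have retK v : cube v -> ret (emb v) = v.
  by move=> vC; apply/funext => i; rewrite /ret/emb mulrC divfK ?gt_eqF// addrK clip_id.
have embS v : cube v -> simplex (emb v).
  move=> vC; have ge0 i : 0 <= (v i + C) / K.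
    by rewrite divr_ge0 ?(ltW K0)//; have := vC i; rewrite ler_norml => /andP[]; lra.
  split=> [[i|]//=|]; last first.
    rewrite (bigD1 None)//= [X in _ + X](_ : _ = \sum_i (v i + C) / K) ?subrK//.
    rewrite (reindex_omap Some id)/=; last by case.
    by apply: eq_bigl => i; rewrite eqxx.
  rewrite subr_ge0; apply: (@le_trans _ _ (\sum_(i : I) (2 * C) / K)).
    apply: ler_sum => i _; rewrite ler_pM2r ?invr_gt0//.
    by have := vC i; rewrite ler_norml => /andP[]; lra.
  rewrite sumr_const -[X in X <= _]mulr_natr mulrAC ler_pdivrMr// mul1r.
  by rewrite ler_pM2l ?mulr_gt0// ler_nat leqW.
have [||y yS fy] := @brouwer_simplex (option I) None (emb \o f \o ret).
- by move=> v vS; apply/embS/fC/retC.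
- move=> v w vS wS vw; have cv i : f (ret (v n)) i @[n --> om] --> f (ret w) i.
    apply: (fc (fun n => ret (v n)) (ret w)) => // j.
    by apply: om_clip; apply: cvgB; [apply: cvgM|]; first exact: cvg_cst; try exact: cvg_cst.
  case=> [i|] /=; first by apply: cvgM; [apply: cvgD => //|]; exact: cvg_cst.
  apply: cvgB; first exact: cvg_cst.
  apply: om_sum => i _; by apply: cvgM; [apply: cvgD => //|]; exact: cvg_cst.
exists (ret y) => // i.
have yE : y = emb (f (ret y)) by apply/funext => o; rewrite -fy.
by rewrite [in RHS]yE retK//; apply: fC.
Qed.
End Brouwer.

(** * Setwise limits of probability measures *)

Section Setwise.
Context {R : realType} d (T : measurableType d).
Implicit Types (m : probability T R) (f : T -> R).

(** B i is the set where f lies in the i-th cell of a mesh of size e. *)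
Lemma simple_approx f (C e : R) : measurable_fun setT f ->
  (forall z, `|f z| <= C) -> 0 < e ->
  exists (N : nat) (a : nat -> R) (B : nat -> set T),
    (forall i, measurable (B i)) /\
    forall z, `|f z - \sum_(i < N) a i * \1_(B i) z| <= e.
Proof.
move=> mf fC e0.
have C0 : 0 <= C by apply: le_trans (fC point).
pose k z := Num.truncn ((f z + C) / e).
have fz z : 0 <= (f z + C) / e.
  by rewrite divr_ge0 ?(ltW e0)//; have := fC z; rewrite ler_norml => /andP[]; lra.
pose B i := f @^-1` `[i%:R * e - C, i.+1%:R * e - C[%classic.
have kB i z : B i z = (i == k z) :> Prop.
  rewrite /B /= in_itv /= lerBlDr ltrBrDr -ler_pdivlMr// -ltr_pdivrMr//.
  by apply/propext; split=> [|/eqP ->]; [rewrite -truncn_eq// eq_sym|rewrite truncn_itv].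
exists (Num.truncn (2 * C / e)).+1, (fun i => i%:R * e - C), B; split.
  by move=> i; rewrite -[B i]setTI; apply: mf => //; apply: measurable_itv.
move=> z.
have kN : (k z < (Num.truncn (2 * C / e)).+1)%N.
  rewrite ltnS le_truncn// ler_pM2r ?invr_gt0//.
  by have := fC z; rewrite ler_norml => /andP[]; lra.
rewrite (bigD1 (Ordinal kN))//= big1 ?addr0; last first.
  move=> i ik; rewrite indicE memNset ?mulr0//= kB => /eqP ek.
  by case/eqP: ik; apply: val_inj.
rewrite indicE mem_set ?mulr1; last by rewrite kB.
have : B (k z) z by rewrite kB.
rewrite /B /= in_itv /= -natr1 mulrDl mul1r => /andP[h1 h2].
by rewrite ler_norml; apply/andP; split; lra.
Qed.


Lemma bounded_integrable m f C : measurable_fun setT f -> (forall z, `|f z| <= C) ->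
  m.-integrable setT (EFin \o f).
Proof.
move=> mf fC; apply: measurable_bounded_integrable => //.
  by apply: le_lt_trans (probability_le1 m measurableT) _; rewrite ltry.
exists C; split; first by rewrite realE (le_trans _ (fC point))//.
by move=> M CM x _; apply: le_trans (fC x) (ltW CM).
Qed.

Lemma integral_simple m N (a : nat -> R) (B : nat -> set T) :
  (forall i, measurable (B i)) ->
  m.-integrable setT (EFin \o (fun z => \sum_(i < N) a i * \1_(B i) z)) /\
  \int[m]_z (\sum_(i < N) a i * \1_(B i) z) = \sum_(i < N) a i * fine (m (B i)).
Proof.
move=> mB.
have int1 i : m.-integrable setT (EFin \o (fun z => a i * \1_(B i) z)).
  apply: (@bounded_integrable _ _ `|a i|) => [|z].
    by apply: measurable_funM; [exact: measurable_cst|exact: measurable_indic].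
  by rewrite normrM ler_piMr// indicE; case: (_ \in _); rewrite ?normr1 ?normr0.
have intS k : m.-integrable setT (EFin \o (fun z => \sum_(i < k) a i * \1_(B i) z)).
  apply: (@bounded_integrable _ _ (\sum_(i < k) `|a i|)) => [|z].
    apply: measurable_sum => i.
    by apply: measurable_funM; [exact: measurable_cst|exact: measurable_indic].
  apply: le_trans (ler_norm_sum _ _ _) _; apply: ler_sum => i _.
  by rewrite normrM ler_piMr// indicE; case: (_ \in _); rewrite ?normr1 ?normr0.
split=> //; elim: N => [|N IH].
  by rewrite big_ord0; under eq_Rintegral do rewrite big_ord0; rewrite Rintegral_cst// mul0r.
rewrite big_ord_recr/= -IH; under eq_Rintegral do rewrite big_ord_recr/=.
rewrite (RintegralD measurableT (intS N) (int1 N)); congr (_ + _).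
rewrite RintegralZl//; first by rewrite /Rintegral integral_indic// setIT.
apply: (@bounded_integrable _ _ 1) => [|z]; first exact: measurable_indic.
by rewrite indicE; case: (_ \in _); rewrite ?normr1 ?normr0.
Qed.

Lemma Rintegral_dist m f g (e : R) : m.-integrable setT (EFin \o f) ->
  m.-integrable setT (EFin \o g) -> (forall z, `|f z - g z| <= e) ->
  `|\int[m]_z f z - \int[m]_z g z| <= e.
Proof.
move=> If Ig fg.
have If_g : m.-integrable setT (EFin \o (fun z => f z - g z)).
  by rewrite (_ : _ \o _ = (fun z => (EFin \o f) z - (EFin \o g) z)%E)//; exact: integrableB.
rewrite -RintegralB//; apply: le_trans (le_normr_Rintegral _ _) _ => //.
have -> : e = \int[m]_(z in setT) e.
  rewrite Rintegral_cst//; transitivity (e * fine (1%E : \bar R)); first by rewrite mulr1.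
  by congr (e * fine _); rewrite -(probability_setT m).
apply: le_Rintegral => //.
- by have := integrable_norm If_g; apply: eq_integrable.
- apply: (@bounded_integrable _ (cst e) `|e|) => //.
Qed.

Lemma setwise_integral (m_ : nat -> probability T R) m f C :
  (forall B, measurable B -> fine (m_ n B) @[n --> om] --> fine (m B)) ->
  measurable_fun setT f -> (forall z, `|f z| <= C) ->
  \int[m_ n]_z f z @[n --> om] --> \int[m]_z f z.
Proof.
move=> mc mf fC; apply/om_dist => e e0.
have e3 : 0 < e / 3 by rewrite divr_gt0.
have [N [a [B [mB fB]]]] := simple_approx mf fC e3.
have dist (m' : probability T R) : `|\int[m']_z f z - \sum_(i < N) a i * fine (m' (B i))| <= e / 3.
  have [int <-] := integral_simple m' N a mB.
  by apply: Rintegral_dist => //; exact: (bounded_integrable m' mf fC).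
have : \sum_(i < N) a i * fine (m_ n (B i)) @[n --> om] --> \sum_(i < N) a i * fine (m (B i)).
  by apply: om_sum => i _; apply: cvgM; [exact: cvg_cst|exact: mc].
move/om_dist/(_ _ e3); apply: filterS => n.
have := dist (m_ n); have := dist m.
rewrite !ler_norml => /andP[? ?] /andP[? ?] /andP[? ?]; apply/andP; split; lra.
Qed.
End Setwise.

Lemma borel_continuous (R : realType) (X : ptopologicalType) (f : X -> R) :
  continuous f -> measurable_fun [set: borel X] (f : borel X -> R).
Proof.
move=> /continuousP cf; apply: (measurability _ (RGenOpens.measurableE R)).
move=> _ [_ [a [b ->] <-]]; rewrite setTI; apply: sub_sigma_algebra.
exact/cf/interval_open.
Qed.

(** Bounded continuous functions are uniform limits of simple functions, whose
    integrals converge by hypothesis. *)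
Lemma setwise_cvg (R : realType) (X : ptopologicalType)
    (m_ : nat -> probability (borel X) R) (m : probability (borel X) R) :
  (forall B, measurable B -> fine (m_ n B) @[n --> om] --> fine (m B)) ->
  (m_ : nat -> prob R X) @ om --> (m : prob R X).
Proof.
move=> mc.
suff H : (fun n => integrate (m_ n)) @ om --> integrate m.
  move=> A [_ [[W oW <-] Wm] WA].
  have /H : nbhs (integrate m) W by apply: open_nbhs_nbhs.
  rewrite /nbhs/= /fmap/= => HW.
  by apply: filterS HW => n; apply: WA.
apply/cvg_sup => -[f [cf [C fC]]] A [_ [[B oB <-] Bm] BA].
have : \int[m_ n]_z (f : borel X -> R) z @[n --> om] --> \int[m]_z (f : borel X -> R) z; last first.
  move=> /(_ _ (open_nbhs_nbhs (conj oB Bm))); rewrite /nbhs/= /fmap/= => HB.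
  by apply: filterS HB => n; apply: BA.
apply: (@setwise_integral R _ (borel X) _ _ _ C) => //.
exact: borel_continuous.
Qed.

(** * Laws with a prescribed marginal *)

Section UltraMeasure.
Context {R : realType} d (T : measurableType d).
Variables (m_ : nat -> probability T R) (lam : {measure set T -> \bar R}).
Hypotheses (lamT : (lam setT < +oo)%E)
  (dominated : forall n B, measurable B -> (m_ n B <= lam B)%E).

(* The norm only makes the value nonnegative on nonmeasurable sets. *)
Definition ultra_measure (B : set T) : \bar R :=
  (`|lim (fine (m_ n B) @[n --> om])|)%:E.

Let fin_m n B : measurable B -> m_ n B \is a fin_num.
Proof. by move=> mB; apply: fin_num_measure. Qed.

Let fin_lam B : measurable B -> lam B \is a fin_num.
Proof.
move=> mB; rewrite ge0_fin_numE//; apply: le_lt_trans lamT.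
by apply: le_measure; rewrite ?inE.
Qed.

Lemma ultra_measureP B : measurable B ->
  fine (m_ n B) @[n --> om] --> fine (ultra_measure B).
Proof.
move=> mB; have [n|l [lC ml]] := @om_bounded R (fun n => fine (m_ n B)) 1.
  rewrite ger0_norm ?fine_ge0// -lee_fin fineK ?fin_m//.
  exact: probability_le1.
have l0 : 0 <= l.
  apply: (om_le (u := cst 0)) ml _; first exact: cvg_cst.
  by move=> n; apply: fine_ge0.
by rewrite /ultra_measure /= (cvg_lim _ ml)// ger0_norm.
Qed.

Let nu := ultra_measure.

Let nu0 : nu set0 = 0%E.
Proof.
have := ultra_measureP measurable0; rewrite -/nu.
under eq_fun do rewrite measure0.
by move=> /(om_unique (cvg_cst _)) e; rewrite [nu set0](_ : _ = (fine (nu set0))%:E)// -e.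
Qed.

Let nu_ge0 B : (0 <= nu B)%E.
Proof. by rewrite lee_fin. Qed.

(* Finite additivity passes to the limit. The mass of the tail of a disjoint
   union is at most its lam-mass, which tends to 0. *)
Let nu_sigma_additive : semi_sigma_additive nu.
Proof.
move=> F mF tF mU.
have fin_nu B : (nu B) = (fine (nu B))%:E by [].
pose U n := \big[setU/set0]_(0 <= i < n) F i.
have mUn n : measurable (U n) by apply: bigsetU_measurable.
have UF n : U n `<=` \bigcup_i F i.
  by rewrite /U big_mkord; apply: bigsetU_bigcup.
have mD n : measurable (\bigcup_i F i `\` U n) by apply: measurableD.
have split (m : {measure set T -> \bar R}) n :
    m (\bigcup_i F i) = (\sum_(0 <= i < n) m (F i) + m (\bigcup_i F i `\` U n))%E.
  rewrite (measureDI m mU (mUn n)) setIidr// addeC /U !big_mkord; congr (_ + _)%E.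
  by rewrite measure_bigsetU.
have nu_split n : fine (nu (\bigcup_i F i)) =
    \sum_(0 <= i < n) fine (nu (F i)) + fine (nu (\bigcup_i F i `\` U n)).
  apply: (@om_unique _ (fun k => fine (m_ k (\bigcup_i F i)))); first exact: ultra_measureP.
  under eq_fun => k.
    rewrite (split _ n) fineD ?fin_m//; last first.
      by apply/sum_fin_numP => i _ _; apply: fin_m.
    rewrite -sum_fine; last by move=> i _; apply: fin_m.
    over.
  by apply: cvgD; [apply: om_sum => i _|]; apply: ultra_measureP.
have lam_split n : fine (lam (\bigcup_i F i)) =
    \sum_(0 <= i < n) fine (lam (F i)) + fine (lam (\bigcup_i F i `\` U n)).
  rewrite (split lam n) fineD ?fin_lam//; last first.
    by apply/sum_fin_numP => i _ _; apply: fin_lam.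
  by rewrite -sum_fine// => i _; apply: fin_lam.
have nu_lam B : measurable B -> fine (nu B) <= fine (lam B).
  move=> mB; apply: om_le (ultra_measureP mB) (cvg_cst _) _ => n.
  by apply: fine_le; rewrite ?fin_m ?fin_lam// dominated.
have lam_cvg : \sum_(0 <= i < n) fine (lam (F i)) @[n --> \oo] --> fine (lam (\bigcup_i F i)).
  have := @measure_semi_sigma_additive _ _ _ lam F mF tF mU.
  rewrite -{1}(fineK (fin_lam mU)) => /fine_cvg; apply: cvg_trans.
  apply: near_eq_cvg; near=> n => /=.
  by rewrite sum_fine// => i _; apply: fin_lam.
have key : \sum_(0 <= i < n) fine (nu (F i)) @[n --> \oo] --> fine (nu (\bigcup_i F i)).
  apply/cvgrPdist_le => e e0.
  move/cvgrPdist_le : lam_cvg => /(_ e e0); apply: filterS => n.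
  rewrite (nu_split n) (lam_split n) ![_ + _ - _]addrAC !subrr !add0r.
  rewrite !ger0_norm ?fine_ge0// => h; apply: le_trans h.
  exact: nu_lam.
rewrite [X in _ --> X]fin_nu.
under eq_fun do rewrite sumEFin.
by apply: cvg_EFin; [near=> n|exact: key].
Unshelve. all: by end_near. Qed.

HB.instance Definition _ := isMeasure.Build _ _ _ nu nu0 nu_ge0 nu_sigma_additive.

Let nuT : nu setT = 1%E.
Proof.
have := ultra_measureP measurableT; rewrite -/nu.
under eq_fun do rewrite probability_setT.
by move=> /(om_unique (cvg_cst _)) e; rewrite [nu setT](_ : _ = (fine (nu setT))%:E)// -e.
Qed.

HB.instance Definition _ := Measure_isProbability.Build _ _ _ nu nuT.

Lemma exists_ultra_limit : exists m : probability T R,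
  forall B, measurable B -> fine (m_ n B) @[n --> om] --> fine (m B).
Proof. by exists nu => B mB; apply: ultra_measureP. Qed.

End UltraMeasure.

Section Densities.
Context {R : realType} {d : nat} {U : pmetricType R}.
Variable mu : probability (borel U) R.
Local Notation S := (state d).
Local Notation BUS := (borel (U * S)%type).
Local Notation PUS := (prob R (U * S)%type).

Definition slice (x : S) (u : borel U) : BUS := (u, x).

Lemma borel_borel (X Y : ptopologicalType) (f : X -> Y) :
  continuous f -> measurable_fun [set: borel X] (f : borel X -> borel Y).
Proof.
move=> /continuousP cf; apply: (@measurability _ _ (borel X) (borel Y) setT f (@open Y) erefl).
move=> _ [A oA <-]; rewrite setTI; apply: sub_sigma_algebra; exact: cf.
Qed.

Lemma measurable_slice x : measurable_fun setT (slice x).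
Proof.
have c : continuous (fun u : U => (u, x) : (U * S)%type); last exact: (borel_borel c).
move=> u A [[P Q] /= [Pu Qx] PQ]; rewrite nbhs_simpl /=.
by apply: filterS Pu => v Pv; apply: PQ; split=> //=; exact: nbhs_singleton Qx.
Qed.

Lemma measurable_cylinder (A : set (borel U)) : measurable A ->
  measurable (A `*` [set: S] : set BUS).
Proof.
move=> mA; have c : continuous (fst : (U * S)%type -> U) by case=> u x; exact: cvg_fst.
have := borel_borel c measurableT mA; rewrite setTI.
by congr (measurable _); apply/seteqP; split=> -[u x] //= [].
Qed.

Lemma measurable_layer x : measurable ([set: borel U] `*` [set x] : set BUS).
Proof.
have c : continuous (snd : (U * S)%type -> S) by case=> u y; exact: cvg_snd.
apply: sub_sigma_algebra; rewrite (_ : _ `*` _ = snd @^-1` [set x]); last first.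
  by apply/seteqP; split=> -[u y] //= [].
by move/continuousP: c; apply; exact: discrete_open.
Qed.

Definition layer (nu : {measure set (borel U) -> \bar R}) x : {measure set BUS -> \bar R} :=
  measure_function_pushforward__canonical__measure_function_Measure nu (measurable_slice x).

(** The measure on U * S whose restriction to U * {x} is nu x. *)
Definition stack (nu : S -> {measure set (borel U) -> \bar R}) : {measure set BUS -> \bar R} :=
  msum (fun k => layer (nu (inord k)) (inord k)) d.+1.

Lemma stackE nu B : stack nu B = (\sum_(x : S) nu x (slice x @^-1` B))%E.
Proof.
by rewrite /stack /= /msum; apply: eq_bigr => k _; rewrite inord_val.
Qed.

(** The part of B in the layer of x is contained in a cylinder over the slice of
    B at x, and m gives to cylinders the mass of their base. *)
Lemma P_mu_le_stack (m : PUS) B : P_mu mu m -> measurable B ->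
  ((m : probability BUS R) B <= stack (fun=> mu) B)%E.
Proof.
move=> Pm mB; rewrite stackE.
pose L x : set BUS := [set: borel U] `*` [set x].
have mL x : measurable (B `&` L x) by apply: measurableI => //; exact: measurable_layer.
have BE : B = \bigcup_(x in [set` index_enum S]) (B `&` L x).
  apply/seteqP; split=> [[u x] Bux|z [x _ []]//].
  by exists x; rewrite //= mem_index_enum.
have -> : (m : probability BUS R) B = (\sum_(x : S) (m : probability BUS R) (B `&` L x))%E.
  rewrite [in LHS]BE measure_fin_bigcup//; first by rewrite -fsbig_seq// index_enum_uniq.
  - by move=> x y _ _ [[u z] /= [[_ [_ <-]] [_ [_ <-]]]].
apply: lee_sum => x _.
have mBx : measurable (slice x @^-1` B).
  by have := measurable_slice x measurableT mB; rewrite setTI.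
have : ((m : probability BUS R) (B `&` L x) <=
        (m : probability BUS R) ((slice x @^-1` B) `*` [set: S]))%E; last by rewrite Pm.
apply: le_measure; rewrite ?inE//; first exact: measurable_cylinder.
by move=> [u y] /= [Buy [_ e]]; split=> //; rewrite /slice -e.
Qed.

(** Setwise limits of elements of P_mu stay countably additive because all of
    them lie below the one finite measure that puts mu on every layer. *)
Lemma P_mu_compact (m_ : nat -> PUS) : (forall n, P_mu mu (m_ n)) ->
  exists2 m : PUS, P_mu mu m & forall B : set BUS, measurable B ->
    fine ((m_ n : probability BUS R) B) @[n --> om] --> fine ((m : probability BUS R) B).
Proof.
move=> Pm.
have [||m mE] := @exists_ultra_limit R _ BUS m_ (stack (fun=> mu)).
- rewrite stackE; apply: (@le_lt_trans _ _ (\sum_(x : S) 1)%E).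
    by apply: lee_sum => x _; rewrite preimage_setT; apply: probability_le1.
  by rewrite sumEFin ltry.
- by move=> n B mB; apply: P_mu_le_stack.
exists m => // A mA.
have := mE _ (measurable_cylinder mA).
under eq_fun => n do rewrite (Pm n _ mA).
move=> /(om_unique (cvg_cst _)) e.
by rewrite -[LHS]fineK -1?e ?fineK// fin_num_measure//; exact: measurable_cylinder.
Qed.

Lemma prob_vectors_le1 (q : S -> U -> R) x u : prob_vectors q -> q x u <= 1.
Proof.
by case=> _ q0 /(_ u) <-; rewrite (bigD1 x)//= lerDl sumr_ge0.
Qed.

Section Law.
Variable q : S -> U -> R.
Hypothesis qP : prob_vectors q.

Definition weighted x (A : set (borel U)) : \bar R := (\int[mu]_(u in A) (q x u)%:E)%E.

Let mq x : measurable_fun [set: borel U] (fun u : borel U => (q x u)%:E).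
Proof. by apply/measurable_EFinP; case: qP. Qed.

Let w0 x : weighted x set0 = 0%E. Proof. by rewrite /weighted integral_set0. Qed.
Let w_ge0 x A : (0 <= weighted x A)%E.
Proof. by apply: integral_ge0 => u _; rewrite lee_fin; case: qP. Qed.
Let w_sigma x : semi_sigma_additive (weighted x).
Proof.
move=> F mF tF mU; rewrite /weighted ge0_integral_bigcup//.
- by apply: is_cvg_ereal_nneg_natsum => n _; apply: w_ge0.
- exact: measurable_funTS.
- by move=> u _; rewrite lee_fin; case: qP.
Qed.
HB.instance Definition _ x := isMeasure.Build _ _ _ (weighted x) (w0 x) (@w_ge0 x) (@w_sigma x).

Definition law_of : set BUS -> \bar R := stack (fun x => weighted x).
HB.instance Definition _ := Measure.copy law_of (stack (fun x => weighted x)).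

Let law_setT : law_of setT = 1%E.
Proof.
rewrite /law_of stackE; under eq_bigr do rewrite preimage_setT.
rewrite /weighted -ge0_integral_sum//; last by move=> x u _; rewrite lee_fin; case: qP.
under eq_integral do rewrite sumEFin.
case: qP => _ _ q1; under eq_integral do rewrite q1.
by rewrite integral_cst// mul1e; exact: (probability_setT mu).
Qed.

HB.instance Definition _ := Measure_isProbability.Build _ _ _ law_of law_setT.

Lemma exists_law : exists m : PUS, forall B : set BUS,
  (m : probability BUS R) B = (\sum_(x : S) \int[mu]_(u in slice x @^-1` B) (q x u)%:E)%E.
Proof. by exists (law_of : probability BUS R) => B; rewrite /= /law_of stackE. Qed.

End Law.

(** The measure q_x(u) mu(du), when q consists of probability vectors; the Dirac
    mass is a default value. *)
Definition law (q : S -> U -> R) : PUS :=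
  xget (dirac point : probability BUS R) [set m : PUS | forall B : set BUS,
    (m : probability BUS R) B =
      (\sum_(x : S) \int[mu]_(u in slice x @^-1` B) (q x u)%:E)%E].

Lemma lawE q B : prob_vectors q -> (law q : probability BUS R) B =
  (\sum_(x : S) \int[mu]_(u in slice x @^-1` B) (q x u)%:E)%E.
Proof.
move=> qP; rewrite /law; case: xgetP => [m _ //|/(_ _)].
by have [m mE] := exists_law qP => /(_ m).
Qed.

Lemma law_disintegrates q : prob_vectors q -> disintegrates mu (law q) q.
Proof.
move=> qP; split=> // x A mA; rewrite lawE// (bigD1 x)//= big1 ?adde0; last first.
  move=> y yx; rewrite (_ : _ @^-1` _ = set0) ?integral_set0//.
  by apply/seteqP; split=> u //= [_ /= e]; rewrite e eqxx in yx.
by congr (integral _ _ _); apply/seteqP; split=> u //= [].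
Qed.

Lemma law_P_mu q : prob_vectors q -> P_mu mu (law q).
Proof.
move=> qP A mA; rewrite lawE//.
have -> : (\sum_(x : S) \int[mu]_(u in slice x @^-1` (A `*` [set: S])) (q x u)%:E =
    \sum_(x : S) \int[mu]_(u in A) (q x u)%:E)%E.
  by apply: eq_bigr => x _; congr (integral _ _ _); apply/seteqP; split=> u //= [].
case: (qP) => mq q0 q1; rewrite -ge0_integral_sum//.
- under eq_integral do rewrite sumEFin q1.
  by rewrite integral_cst// mul1e.
- by move=> x; apply: measurable_funTS; apply/measurable_EFinP.
- by move=> x u _; rewrite lee_fin.
Qed.

(** With mu fixed, only the densities differ, in each of the d + 1 layers. *)
Lemma law_dist q q' (e : R) B : prob_vectors q -> prob_vectors q' ->
  (forall x u, `|q x u - q' x u| <= e) -> measurable B ->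
  `|fine ((law q : probability BUS R) B) - fine ((law q' : probability BUS R) B)|
    <= d.+1%:R * e.
Proof.
move=> qP qP' qq mB.
have mBx x : measurable (slice x @^-1` B).
  by have := measurable_slice x measurableT mB; rewrite setTI.
have int (p : S -> U -> R) x : prob_vectors p -> mu.-integrable setT (EFin \o (p x : borel U -> R)).
  move=> pP; apply: (@bounded_integrable _ _ _ mu _ 1); first by case: pP.
  by move=> u; have [_ p0 _] := pP; rewrite (ger0_norm (p0 x u)); exact: (prob_vectors_le1 x u pP).
have intB (p : S -> U -> R) x : prob_vectors p -> mu.-integrable (slice x @^-1` B) (EFin \o (p x : borel U -> R)).
  by move=> pP; apply: integrableS (int p x pP).
have fE p : prob_vectors p -> fine ((law p : probability BUS R) B) =
    \sum_(x : S) \int[mu]_(u in slice x @^-1` B) p x u.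
  move=> pP; rewrite lawE// -sum_fine//.
  by move=> x _; apply: integrable_fin_num => //; exact: intB.
rewrite !fE// -sumrB; apply: le_trans (ler_norm_sum _ _ _) _.
apply: (@le_trans _ _ (\sum_(x : S) e)); last first.
  by rewrite sumr_const card_ord mulr_natl.
apply: ler_sum => x _; rewrite -RintegralB//; [|exact: intB..].
have e0 : 0 <= e by apply: le_trans (qq x point).
have If_g : mu.-integrable (slice x @^-1` B) (EFin \o (fun u : borel U => q x u - q' x u)).
  rewrite (_ : _ \o _ = (fun z => (EFin \o q x) z - (EFin \o q' x) z)%E)//.
  by apply: integrableB => //; exact: intB.
apply: le_trans (le_normr_Rintegral _ If_g) _ => //.
apply: (@le_trans _ _ (\int[mu]_(u in slice x @^-1` B) e)).
  apply: le_Rintegral => //.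
    by have := integrable_norm If_g; apply: eq_integrable.
  have Ie : mu.-integrable setT (EFin \o (cst e : borel U -> R)).
    by apply: (@bounded_integrable _ _ _ mu _ `|e|).
  exact: integrableS Ie.
rewrite Rintegral_cst// ler_piMr//.
by rewrite -lee_fin fineK ?fin_num_measure//; exact: probability_le1.
Qed.

End Densities.

(** * Uniform continuity with respect to laws *)

Lemma fin_delta (R : realType) (I : finType) (Q : I -> R -> Prop) :
  (forall i, exists2 e : R, 0 < e & Q i e) ->
  (forall i e e', 0 < e' -> e' <= e -> Q i e -> Q i e') ->
  exists2 e : R, 0 < e & forall i, Q i e.
Proof.
move=> H mono.
have H' i : exists e, 0 < e /\ Q i e by have [e e0 Qe] := H i; exists e.
have [e He] := choice H'.
exists (\big[Num.min/1]_i e i).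
  by apply: lt_bigmin => // i _; have [] := He i.
move=> i; have [ei Qi] := He i; apply: mono Qi; last exact: bigmin_le_cond.
by apply: lt_bigmin => // j _; have [] := He j.
Qed.

Section Equicontinuity.
Context {R : realType} {d : nat} {U : pmetricType R}.
Variable mu : probability (borel U) R.
Local Notation S := (state d).
Local Notation BUS := (borel (U * S)%type).
Local Notation PUS := (prob R (U * S)%type).
Hypothesis cU : compact [set: U].

Lemma om_point (u : nat -> U) : exists l : U, u @ om --> l.
Proof. by have [//|l _ ul] := om_compact cU (u := u); exists l. Qed.

Lemma om_close (u v : nat -> U) (l : U) : u @ om --> l ->
  (forall n, ball (u n) (n.+1%:R^-1) (v n)) -> v @ om --> l.
Proof.
move=> ul uv; apply/cvg_ballP => e e0.
have e2 : 0 < e / 2 by rewrite divr_gt0.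
have /om_dist/(_ (e / 4)) := @om_harmonic R; rewrite divr_gt0// => /(_ isT) h.
move/cvg_ballP : ul => /(_ _ e2); apply: filterS2 h => n.
rewrite subr0 ger0_norm ?invr_ge0// => h b.
rewrite (splitr e); apply: ball_triangle b _.
by apply: le_ball (uv n); apply: le_trans h _; rewrite ler_pM2l// lef_pV2 ?posrE// ler_nat.
Qed.

(** Pairs violating the estimate for smaller and smaller dl would have a common
    limit by [P_mu_compact], at which F is continuous. The sup distance of
    densities stands in for a metric of the weak topology. *)
Lemma assumption2_uniform (F : S -> PUS -> U -> R) : assumption2 mu F ->
  forall e : R, 0 < e -> exists2 dl : R, 0 < dl &
    forall x q q' u u', prob_vectors q -> prob_vectors q' ->
      (forall y v, `|q y v - q' y v| <= dl) -> ball u dl u' ->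
      `|F x (law mu q) u - F x (law mu q') u'| <= e.
Proof.
move=> [_ cF] e e0; apply: fin_delta => [x|x dl dl' dl0 le H q q' u u' qP qP' qq uu]; last first.
  apply: H => //; last exact: le_ball uu.
  by move=> y v; apply: le_trans (qq y v) le.
apply: contrapT => noe.
have bad n : exists a : ((S -> U -> R) * (S -> U -> R)) * (U * U),
    [/\ prob_vectors a.1.1, prob_vectors a.1.2,
     (forall y v, `|a.1.1 y v - a.1.2 y v| <= n.+1%:R^-1),
     ball a.2.1 (n.+1%:R^-1) a.2.2 &
     ~ `|F x (law mu a.1.1) a.2.1 - F x (law mu a.1.2) a.2.2| <= e].
  apply: contrapT => none; apply: noe; exists (n.+1%:R^-1) => // q q' u u' qP qP' qq uu.
  by apply: contrapT => H; apply: none; exists ((q, q'), (u, u')).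
have [a Ha] := choice bad.
have [l ul] := om_point (fun n => (a n).2.1).
have ul' : (fun n => (a n).2.2) @ om --> l by apply: om_close ul _ => n; have [] := Ha n.
have [m Pm mc] := @P_mu_compact R d U mu (fun n => law mu (a n).1.1)
   (fun n => law_P_mu mu (let: And5 h _ _ _ _ := Ha n in h)).
have mc' (B : set BUS) : measurable B -> fine ((law mu (a n).1.2 : probability BUS R) B) @[n --> om] -->
    fine ((m : probability BUS R) B).
  move=> mB; apply/om_dist => r r0; have r2 : 0 < r / 2 by rewrite divr_gt0.
  have dn : (d.+1%:R * n.+1%:R^-1 : R) @[n --> om] --> (0 : R).
    by rewrite -(mulr0 d.+1%:R); apply: cvgM; [exact: cvg_cst|exact: om_harmonic].
  have /om_dist/(_ _ r2) := dn; have /om_dist/(_ _ r2) := mc B mB.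
  apply: filterS2 => n h1; rewrite subr0 ger0_norm ?mulr_ge0// => h2.
  have [q1 q2 qq _ _] := Ha n; have := le_trans (law_dist mu q1 q2 qq mB) h2.
  move: h1; rewrite !ler_norml => /andP[? ?] /andP[? ?]; apply/andP; split; lra.
have cvgF (q : nat -> S -> U -> R) (v : nat -> U) : (forall n, prob_vectors (q n)) ->
    v @ om --> l ->
    (forall B : set BUS, measurable B -> fine ((law mu (q n) : probability BUS R) B) @[n --> om] -->
    fine ((m : probability BUS R) B)) ->
    F x (law mu (q n)) (v n) @[n --> om] --> F x m l.
  move=> qP vl ql; have qm := setwise_cvg ql.
  have /subspace_continuousP := cF x.
  move=> /(_ (m, l) (conj Pm I)) cFm.
  apply: (cvg_comp (fun n => (law mu (q n), v n) : PUS * U)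
    (fun z : PUS * U => F x z.1 z.2) _ cFm).
  move=> A [[P Q] /= [Pm' Ql] PQ].
  have h1 := qm _ Pm'; have h2 := vl _ Ql.
  move: h1 h2; rewrite /nbhs/= /fmap/=; apply: filterS2 => n h1 h2.
  by apply: (PQ (_, _)) => //; split=> //=; apply: law_P_mu.
have c1 := cvgF (fun n => (a n).1.1) _ (fun n => let: And5 h _ _ _ _ := Ha n in h) ul mc.
have c2 := cvgF (fun n => (a n).1.2) _ (fun n => let: And5 _ h _ _ _ := Ha n in h) ul' mc'.
have c12 : F x (law mu (a n).1.1) (a n).2.1 - F x (law mu (a n).1.2) (a n).2.2 @[n --> om] --> (0 : R).
  by rewrite -(subrr (F x m l)); exact: cvgB.
have /filter_ex[n] := (om_dist _ _).1 c12 e e0; rewrite subr0.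
by have [_ _ _ _] := Ha n.
Qed.

End Equicontinuity.

(** * The Hamiltonian *)

Section Hamiltonian.
Context {R : realType} {d : nat} {U : pmetricType R}.
Local Notation S := (state d).
Local Notation vec := 'rV[R]_d.+1.
Hypothesis cU : compact [set: U].

Lemma compact_bound (f : U -> R) : continuous f -> exists2 C : R, 0 <= C & forall u, `|f u| <= C.
Proof.
move=> cf; apply: contrapT => H.
have bad n : exists u, n%:R < `|f u|.
  apply: contrapT => none; apply: H; exists n%:R => // u.
  by rewrite leNgt; apply/negP => h; apply: none; exists u.
have [u Hu] := choice bad.
have [l ul] := om_point cU u.
have c : `|f (u n)| @[n --> om] --> `|f l|.
  by apply: cvg_norm; apply: continuous_cvg => //; exact: cf.
pose N := (Num.truncn (`|f l| + 1)).+1.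
have fN : `|f l| + 1 < N%:R by rewrite truncnS_gt.
have big : \forall n \near om, (N <= n)%N.
  by apply: om_oo; exists N.
have /om_dist/(_ 1 ltr01) := c; move/filterI => /(_ _ big) /filter_ex[n [+ Nn]].
rewrite ler_norml => /andP[_]; have := Hu n; have : (N%:R : R) <= n%:R by rewrite ler_nat.
lra.
Qed.

Variables (L : S -> vec -> U -> R) (dL : S -> vec -> U -> vec) (gamma : R).
Hypotheses (gamma0 : 0 < gamma)
  (cL : forall x a, orthant a -> continuous (L x a))
  (cdL : forall x a, orthant a -> continuous (dL x a))
  (convL : forall x a a' u, orthant a -> orthant a' ->
        L x a u + dotv (dL x a u) (a' - a)
          + gamma * \sum_(y < d.+1) (a' ord0 y - a ord0 y) ^+ 2 <= L x a' u).
Let gamma_neq0 : gamma != 0. Proof. by rewrite gt_eqF. Qed.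
Implicit Types (x y : S) (p a b : vec) (u : U).

(** The gradient in a of the cost minimized by the Hamiltonian. *)
Definition slope x p u a (y : S) : R := (y != x)%:R * p ord0 y + dL x a u ord0 y.

Lemma cost_tangent x p u a b : orthant a -> orthant b ->
  cost L x p u a + \sum_(y : S) slope x p u a y * (b ord0 y - a ord0 y)
    + gamma * \sum_(y : S) (b ord0 y - a ord0 y) ^+ 2 <= cost L x p u b.
Proof.
move=> ao bo; have := convL x u ao bo; rewrite /cost /dotv /slope.
rewrite [\sum_(y : S | _) a _ _ * _]big_mkcond [\sum_(y : S | _) b _ _ * _]big_mkcond /=.
have -> : \sum_(y : S) ((y != x)%:R * p ord0 y + dL x a u ord0 y) * (b ord0 y - a ord0 y)
   = \sum_(y : S) (if y != x then b ord0 y * p ord0 y else 0)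
     - \sum_(y : S) (if y != x then a ord0 y * p ord0 y else 0)
     + \sum_(y < d.+1) dL x a u ord0 y * (b - a) ord0 y.
  rewrite -sumrB -big_split/=; apply: eq_bigr => y _; rewrite !mxE.
  by case: (y != x) => /=; ring.
by move=> h; lra.
Qed.

Lemma orthant_mid a b : orthant a -> orthant b -> orthant (2^-1 *: (a + b)).
Proof. by move=> ao bo y; rewrite !mxE mulr_ge0// addr_ge0. Qed.

Lemma orthant0 : orthant (0 : vec).
Proof. by move=> y; rewrite mxE. Qed.

(** The tangent inequality at the midpoint of a and b, applied to a and to b,
    bounds the cost at the midpoint, which is at least the minimum. *)
Lemma minimizer_growth x p u a b : is_minimizer L x p u a -> orthant b ->
  cost L x p u a + gamma / 2 * \sum_(y : S) (b ord0 y - a ord0 y) ^+ 2 <= cost L x p u b.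
Proof.
move=> [ao amin] bo; set c := 2^-1 *: (a + b).
have co : orthant c by apply: orthant_mid.
have ca := cost_tangent x p u co ao; have cb := cost_tangent x p u co bo.
have := amin _ co.
have e1 : \sum_(y : S) slope x p u c y * (a ord0 y - c ord0 y) =
    - \sum_(y : S) slope x p u c y * (b ord0 y - c ord0 y).
  by rewrite -sumrN; apply: eq_bigr => y _; rewrite !mxE; field.
have e2 : \sum_(y : S) (a ord0 y - c ord0 y) ^+ 2 = 4^-1 * \sum_(y : S) (b ord0 y - a ord0 y) ^+ 2.
  by rewrite mulr_sumr; apply: eq_bigr => y _; rewrite !mxE; field.
have e3 : \sum_(y : S) (b ord0 y - c ord0 y) ^+ 2 = 4^-1 * \sum_(y : S) (b ord0 y - a ord0 y) ^+ 2.
  by rewrite mulr_sumr; apply: eq_bigr => y _; rewrite !mxE; field.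
move: ca cb; rewrite e1 e2 e3; set X := \sum_(y : S) _; set Y := \sum_(y : S) _.
rewrite (_ : gamma * (4^-1 * Y) = gamma / 4 * Y); last by ring.
rewrite (_ : gamma / 2 * Y = gamma / 4 * Y + gamma / 4 * Y); last by field.
lra.
Qed.

Lemma minimizer_unique x p u a b : is_minimizer L x p u a -> is_minimizer L x p u b -> a = b.
Proof.
move=> am bm; have := minimizer_growth am (proj1 bm).
have := (proj2 bm) _ (proj1 am); set s := \sum_(y : S) _ => h1 h2.
have s0 : 0 <= s by apply: sumr_ge0 => y _; apply: sqr_ge0.
have : s = 0 by apply/eqP; rewrite eq_le s0 andbT -(pmulr_rle0 _ (_ : 0 < gamma / 2)) ?divr_gt0//; lra.
move=> /eqP; rewrite psumr_eq0; last by move=> y _; apply: sqr_ge0.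
move=> /allP H; apply/rowP => y; have := H y (mem_index_enum _).
by rewrite sqrf_eq0 subr_eq0 => /eqP.
Qed.

(** The tangent inequality at 0, where the linear term is absorbed by half of
    the quadratic one. *)
Lemma cost_coercive x p u b (M : R) : orthant b ->
  (forall y, `|slope x p u 0 y| <= M) ->
  cost L x p u 0 + gamma / 2 * \sum_(y : S) b ord0 y ^+ 2 - d.+1%:R * (M ^+ 2 / (2 * gamma))
    <= cost L x p u b.
Proof.
move=> bo sM; have := cost_tangent x p u orthant0 bo.
under eq_bigr do rewrite mxE; under [\sum_(y : S) _ ^+ 2]eq_bigr do rewrite mxE.
move=> tangent; apply: le_trans tangent.
suff : \sum_(y : S) (gamma / 2 * b ord0 y ^+ 2 - M ^+ 2 / (2 * gamma)) <=
    \sum_(y : S) (slope x p u 0 y * (b ord0 y - 0) + gamma * (b ord0 y - 0) ^+ 2).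
  rewrite sumrB big_split/= -!mulr_sumr sumr_const card_ord -[_ *+ d.+1]mulr_natl.
  lra.
apply: ler_sum => y _; rewrite subr0.
have := sM y; rewrite ler_norml => /andP[s1 s2]; have by0 : 0 <= b ord0 y by apply: bo.
have h : - M * b ord0 y <= slope x p u 0 y * b ord0 y by rewrite ler_wpM2r.
apply: le_trans (lerD h (lexx _)).
rewrite -subr_ge0 (_ : _ - _ = gamma / 2 * (b ord0 y - M / gamma) ^+ 2); last by field.
by rewrite mulr_ge0 ?sqr_ge0// divr_ge0// ltW.
Qed.

Lemma cost_cvg x a (p_ : nat -> vec) (u_ : nat -> U) p u : orthant a ->
  (forall y, p_ n ord0 y @[n --> om] --> p ord0 y) -> u_ @ om --> u ->
  cost L x (p_ n) (u_ n) a @[n --> om] --> cost L x p u a.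
Proof.
move=> ao pp uu; apply: cvgD.
  by apply: om_sum => y _; apply: cvgM; [exact: cvg_cst|exact: pp].
by apply: continuous_cvg => //; apply: cL.
Qed.

Lemma tangent_cvg x (a : vec) (a_ : nat -> vec) (p_ : nat -> vec) (u_ : nat -> U) p u : orthant a ->
  (forall y, a_ n ord0 y @[n --> om] --> a ord0 y) ->
  (forall y, p_ n ord0 y @[n --> om] --> p ord0 y) -> u_ @ om --> u ->
  cost L x (p_ n) (u_ n) a + \sum_(y : S) slope x (p_ n) (u_ n) a y * (a_ n ord0 y - a ord0 y)
    @[n --> om] --> cost L x p u a.
Proof.
move=> ao aa pp uu; rewrite -[X in _ --> X]addr0; apply: cvgD; first exact: cost_cvg.
rewrite [X in _ --> X](_ : 0 = \sum_(y : S) slope x p u a y * (a ord0 y - a ord0 y)); last first.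
  by rewrite big1// => y _; rewrite subrr mulr0.
apply: om_sum => y _.
apply: cvgM; last by apply: cvgB; [exact: aa|exact: cvg_cst].
apply: cvgD; first by apply: cvgM; [exact: cvg_cst|exact: pp].
have c : (fun u => dL x a u ord0 y) @ u --> dL x a u ord0 y.
  apply: (continuous_comp (f := dL x a) (g := fun v : vec => v ord0 y)); first exact: cdL.
  exact: coord_continuous.
exact: (cvg_comp u_ (fun u => dL x a u ord0 y) uu c).
Qed.

(** Lower semicontinuity of the cost: it lies above its tangent at the limit
    point a, and that tangent converges. *)
Lemma minimizer_limit x (a : vec) (a_ : nat -> vec) (p_ : nat -> vec) (u_ : nat -> U) p u (v : nat -> R) (l : R) :
  (forall n, orthant (a_ n)) ->
  (forall y, a_ n ord0 y @[n --> om] --> a ord0 y) ->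
  (forall y, p_ n ord0 y @[n --> om] --> p ord0 y) -> u_ @ om --> u ->
  v @ om --> l -> (forall n, cost L x (p_ n) (u_ n) (a_ n) <= v n) ->
  orthant a /\ cost L x p u a <= l.
Proof.
move=> ao aa pp uu vl le.
have oa : orthant a.
  by move=> y; apply: (@om_le R (fun=> 0) (fun n => a_ n ord0 y) _ _ (cvg_cst _) (aa y)) => n; apply: ao.
split=> //; apply: (om_le (@tangent_cvg x _ _ _ _ _ _ oa aa pp uu) vl) => n.
apply: le_trans (le n); apply: le_trans (cost_tangent x (p_ n) (u_ n) oa (ao n)).
by rewrite lerDl mulr_ge0 ?(ltW gamma0)// sumr_ge0// => y _; apply: sqr_ge0.
Qed.

Lemma slope_bound x (P : R) : exists2 M : R, 0 <= M &
  forall p u, (forall y, `|p ord0 y| <= P) -> forall y, `|slope x p u 0 y| <= M.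
Proof.
have [C HC] : exists C : S -> R, forall y, 0 <= C y /\ forall u, `|dL x 0 u ord0 y| <= C y.
  suff H y : exists C, 0 <= C /\ forall u, `|dL x 0 u ord0 y| <= C by have [C] := choice H; exists C.
  have c : continuous (fun u => dL x 0 u ord0 y).
    move=> u; apply: (continuous_comp (f := dL x 0) (g := fun v : vec => v ord0 y)).
      by apply: cdL; exact: orthant0.
    exact: coord_continuous.
  by have [C C0 HC] := compact_bound c; exists C.
exists (`|P| + \sum_y C y) => [|p u pP y].
  by rewrite addr_ge0// sumr_ge0// => y _; have [] := HC y.
rewrite /slope; apply: le_trans (ler_normD _ _) _; apply: lerD.
  apply: le_trans (le_trans (pP y) (ler_norm _)).
  by rewrite normrM; case: (y != x); rewrite /= ?normr1 ?normr0 ?mul1r ?mul0r.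
have [_ /(_ u) h] := HC y; apply: le_trans h _.
by rewrite (bigD1 y)//= lerDl sumr_ge0// => z _; have [] := HC z.
Qed.

Lemma coercive_bound x (P : R) : exists K : R, forall p u b, (forall y, `|p ord0 y| <= P) ->
  orthant b -> cost L x p u b <= cost L x p u 0 + 1 -> forall y, `|b ord0 y| <= K.
Proof.
have [M M0 HM] := slope_bound x P.
exists (2 / gamma * (1 + d.+1%:R * (M ^+ 2 / (2 * gamma))) + 1) => p u b pP bo le y.
have := le_trans (cost_coercive bo (HM p u pP)) le.
set k := d.+1%:R * _ => h.
have : b ord0 y ^+ 2 <= \sum_(y : S) b ord0 y ^+ 2.
  by rewrite (bigD1 y)//= lerDl sumr_ge0// => z _; apply: sqr_ge0.
rewrite ger0_norm; last exact: bo.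
move=> h2; have h3 : b ord0 y ^+ 2 <= 2 / gamma * (1 + k).
  apply: le_trans h2 _; rewrite -(ler_pM2l (_ : 0 < gamma / 2)) ?divr_gt0//.
  rewrite mulrA (_ : gamma / 2 * (2 / gamma) = 1); last by field.
  by lra.
have : 0 <= (b ord0 y - 1) ^+ 2 by apply: sqr_ge0.
have : 0 <= b ord0 y ^+ 2 by apply: sqr_ge0.
nra.
Qed.

(** A minimizing sequence is bounded by coercivity; its limit along om is a
    minimizer by [minimizer_limit]. *)
Lemma minimizer_exists x p u : exists a, is_minimizer L x p u a.
Proof.
pose P := \sum_(y : S) `|p ord0 y|.
have pP y : `|p ord0 y| <= P by rewrite /P (bigD1 y)//= lerDl sumr_ge0.
have [K HK] := coercive_bound x P.
have [M M0 HM] := slope_bound x P.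
pose E := [set cost L x p u a | a in @orthant R d].
have Ei : has_inf E.
  split; first by exists (cost L x p u 0); exists 0 => //; exact: orthant0.
  exists (cost L x p u 0 - d.+1%:R * (M ^+ 2 / (2 * gamma))) => _ [b bo <-].
  apply: le_trans (cost_coercive bo (HM p u pP)).
  by rewrite lerD2r lerDl mulr_ge0 ?divr_ge0 ?(ltW gamma0)// sumr_ge0// => y _; apply: sqr_ge0.
have near_min n : exists a, orthant a /\ cost L x p u a <= inf E + n.+1%:R^-1.
  have n0 : 0 < n.+1%:R^-1 :> R by rewrite invr_gt0.
  by have [_ [a ao <-] /ltW ?] := inf_adherent n0 Ei; exists a.
have [a_ Ha] := choice near_min.
have infle b : orthant b -> inf E <= cost L x p u b.
  by move=> bo; apply: inf_lbound; [case: Ei|exists b].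
have aK n y : `|a_ n ord0 y| <= K.
  have [ao le] := Ha n; apply: (HK p u) => //; apply: le_trans le _; apply: lerD.
    by apply: infle; exact: orthant0.
  by rewrite invf_le1// ler1n.
have [l Hl] := choice (fun y => om_bounded (fun n => aK n y)).
pose a : vec := \row_y l y.
have [//|y|y|||n|ao le] := @minimizer_limit x a a_ (fun=> p) (fun=> u) p u (fun n => inf E + n.+1%:R^-1) (inf E).
- by move=> n; have [] := Ha n.
- by rewrite mxE; have [] := Hl y.
- exact: cvg_cst.
- exact: cvg_cst.
- rewrite -[X in _ --> X]addr0; apply: cvgD; [exact: cvg_cst|exact: om_harmonic].
- by have [] := Ha n.
exists a; split=> // b bo; apply: le_trans le _; exact: infle.
Qed.

Lemma astarP x p u : is_minimizer L x p u (astar L x p u).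
Proof. by rewrite /astar; case: xgetP => [a -> //|H]; have [a /H] := minimizer_exists x p u. Qed.

Lemma astar_ge0 x p u y : 0 <= astar L x p u ord0 y.
Proof. by have [ao _] := astarP x p u; apply: ao. Qed.

Lemma hamiltonianE x p u : - hamiltonian L x p u = cost L x p u (astar L x p u).
Proof.
rewrite /hamiltonian opprK; have [ao amin] := astarP x p u.
apply/eqP; rewrite eq_le; apply/andP; split.
  apply: inf_lbound; last by exists (astar L x p u).
  by exists (cost L x p u (astar L x p u)) => _ [b bo <-]; apply: amin.
apply: lb_le_inf; first by exists (cost L x p u (astar L x p u)); exists (astar L x p u).
by move=> _ [b bo <-]; apply: amin.
Qed.

Lemma hamiltonian_le x p u b : orthant b -> - hamiltonian L x p u <= cost L x p u b.
Proof. by move=> bo; rewrite hamiltonianE; apply: (proj2 (astarP x p u)). Qed.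

Lemma astar_bound (P : R) : exists2 A : R, 0 <= A & forall x p u, (forall y, `|p ord0 y| <= P) ->
  forall y, astar L x p u ord0 y <= A.
Proof.
have [K HK] := choice (fun x => coercive_bound x P).
exists (\sum_x `|K x|) => [|x p u pP y]; first exact: sumr_ge0.
apply: le_trans (ler_norm _) _.
apply: (@le_trans _ _ (K x)).
  apply: (HK x p u) => //; have [ao amin] := astarP x p u => //.
  by apply: le_trans (amin _ orthant0) _; rewrite lerDl.
by apply: le_trans (ler_norm _) _; rewrite (bigD1 x)//= lerDl sumr_ge0.
Qed.

(** The minimizers are bounded, their limit minimizes the limit cost, and the
    minimizer of the latter is unique. *)
Lemma astar_cvg x (P : R) (p_ : nat -> vec) (u_ : nat -> U) p u :
  (forall n y, `|p_ n ord0 y| <= P) ->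
  (forall y, p_ n ord0 y @[n --> om] --> p ord0 y) -> u_ @ om --> u ->
  (forall y, astar L x (p_ n) (u_ n) ord0 y @[n --> om] --> astar L x p u ord0 y) /\
  - hamiltonian L x (p_ n) (u_ n) @[n --> om] --> - hamiltonian L x p u.
Proof.
move=> pP pp uu; pose a_ n := astar L x (p_ n) (u_ n).
have [A A0 HA] := astar_bound P.
have ao n : orthant (a_ n) by have [] := astarP x (p_ n) (u_ n).
have aA n y : `|a_ n ord0 y| <= A by rewrite ger0_norm ?HA//; apply: ao.
have [l Hl] := choice (fun y => om_bounded (fun n => aA n y)).
pose a : vec := \row_y l y.
have aa y : a_ n ord0 y @[n --> om] --> a ord0 y by rewrite mxE; have [] := Hl y.
have amin b : orthant b -> orthant a /\ cost L x p u a <= cost L x p u b.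
  move=> bo; apply: (minimizer_limit ao aa pp uu (@cost_cvg x b p_ u_ p u bo pp uu)) => n.
  by have [_] := astarP x (p_ n) (u_ n); apply.
have am : is_minimizer L x p u a.
  by split=> [|b /amin[]//]; have [] := amin _ orthant0.
have aE : astar L x p u = a by apply: minimizer_unique am; apply: astarP.
rewrite aE; split=> //; rewrite hamiltonianE aE.
under eq_fun do rewrite hamiltonianE.
apply: squeeze_cvgr; [|exact: (@tangent_cvg x _ _ _ _ _ _ (proj1 am) aa pp uu)|exact: (@cost_cvg x a p_ u_ p u (proj1 am) pp uu)].
apply: nearW => n; apply/andP; split; last by have [_] := astarP x (p_ n) (u_ n); apply; case: am.
apply: le_trans (cost_tangent x (p_ n) (u_ n) (proj1 am) (ao n)).
by rewrite lerDl mulr_ge0 ?(ltW gamma0)// sumr_ge0// => y _; apply: sqr_ge0.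
Qed.

(** The minimizer for p' is a competitor for p, and the two costs at this point
    differ by its scalar product with p - p'. *)
Lemma hamiltonian_lipschitz x (P A : R) p p' u :
  (forall y, `|p ord0 y| <= P) -> (forall y, `|p' ord0 y| <= P) ->
  (forall p, (forall y, `|p ord0 y| <= P) -> forall y, astar L x p u ord0 y <= A) ->
  `|hamiltonian L x p u - hamiltonian L x p' u| <= A * \sum_(y : S) `|p ord0 y - p' ord0 y|.
Proof.
move=> pP pP' HA.
have half (q q' : vec) : (forall y, `|q' ord0 y| <= P) ->
   - hamiltonian L x q u + hamiltonian L x q' u <= A * \sum_(y : S) `|q ord0 y - q' ord0 y|.
  move=> qP'; have [ao' _] := astarP x q' u.
  have h := hamiltonian_le x q u ao'.
  have e := hamiltonianE x q' u.
  have : cost L x q u (astar L x q' u) - cost L x q' u (astar L x q' u) <=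
      A * \sum_(y : S) `|q ord0 y - q' ord0 y|; last by lra.
  rewrite /cost opprD addrACA subrr addr0 -sumrB mulr_sumr.
  rewrite big_mkcond; apply: ler_sum => y _.
  have A0 : 0 <= A by apply: le_trans (HA _ qP' y); apply: ao'.
  case: ifP => _; last by rewrite mulr_ge0.
  rewrite -mulrBr; apply: le_trans (ler_norm _) _; rewrite normrM ler_pM//.
  by rewrite ger0_norm ?HA//; apply: ao'.
rewrite ler_norml; apply/andP; split.
  by rewrite lerNl opprB; have := half p p' pP'; lra.
have := half p' p pP; under eq_bigr do rewrite distrC; lra.
Qed.

(** For p = 0 the cost is L itself, and [cost_coercive] bounds it below. *)
Lemma running_cost_bound : exists2 B : R, 0 <= B & forall x u,
  L x 0 u <= B /\ forall a, orthant a -> - B <= L x a u.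
Proof.
have H x : exists B : R, 0 <= B /\ forall u, L x 0 u <= B /\ forall a, orthant a -> - B <= L x a u.
  have [C C0 HC] := compact_bound (@cL x 0 orthant0).
  have [M M0 HM] := slope_bound x 0.
  have K0 : 0 <= d.+1%:R * (M ^+ 2 / (2 * gamma)).
    by rewrite mulr_ge0// divr_ge0 ?sqr_ge0// mulr_ge0// ltW.
  exists (C + d.+1%:R * (M ^+ 2 / (2 * gamma))); split; first by rewrite addr_ge0.
  move=> u; have := HC u; rewrite ler_norml => /andP[h1 h2]; split; first by lra.
  move=> a ao; have p0 y : `|(0 : vec) ord0 y| <= 0 by rewrite mxE normr0.
  have := @cost_coercive x 0 u a M ao (HM 0 u p0).
  have cost0 b : cost L x 0 u b = L x b u.
    by rewrite /cost big1 ?add0r// => y _; rewrite mxE mulr0.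
  rewrite !cost0.
  have : 0 <= gamma / 2 * \sum_(y : S) a ord0 y ^+ 2.
    by rewrite mulr_ge0 ?divr_ge0 ?(ltW gamma0)// sumr_ge0// => y _; apply: sqr_ge0.
  move=> h3 h4; lra.
have [B HB] := choice H.
exists (\sum_x B x) => [|x u]; first by rewrite sumr_ge0// => x _; have [] := HB x.
have BB : B x <= \sum_x B x by rewrite (bigD1 x)//= lerDl sumr_ge0// => y _; have [] := HB y.
have [_ /(_ u)[h1 h2]] := HB x; split; first exact: le_trans BB.
by move=> a /h2; apply: le_trans; rewrite lerN2.
Qed.

End Hamiltonian.

(** * The discrete scheme *)

Lemma om_sum0 (R : realType) (I : finType) (u : nat -> I -> R) :
  (forall i, u n i @[n --> om] --> (0 : R)) -> \sum_i u n i @[n --> om] --> (0 : R).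
Proof.
move=> u0; rewrite [X in _ --> X](_ : 0 = \sum_(i : I) 0); last by rewrite big1.
by apply: om_sum => i _; exact: u0.
Qed.

Section FinitePartition.
Context {R : realType} {U : pmetricType R}.
Hypothesis cU : compact [set: U].

(** The cells of the partition below are the level sets of the index of the first
    ball that contains u. *)
Lemma measurable_find (B : U -> set U) (s : seq U) k : (forall c, open (B c)) ->
  measurable ([set u | find (fun c => `[< B c u >]) s = k] : set (borel U)).
Proof.
move=> oB; elim: s k => [|c s IH] k /=.
  have [->|/eqP k0] := eqVneq k 0%N.
    by rewrite (_ : [set _ | _] = setT)//; apply/seteqP; split.
  by rewrite (_ : [set _ | _] = set0)//; apply/seteqP; split=> u //= /esym.
have mB : measurable (B c : set (borel U)) by apply: sub_sigma_algebra; exact: oB.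
case: k => [|k].
  rewrite (_ : [set _ | _] = B c)//; apply/seteqP; split=> u /=.
    by case: asboolP.
  by move=> Bu; rewrite asboolT.
rewrite (_ : [set _ | _] = ~` B c `&` [set u | find (fun c => `[< B c u >]) s = k]).
  by apply: measurableI; [apply: measurableC|exact: IH].
apply/seteqP; split=> u /=; first by case: asboolP => // nB [].
by case=> nB <-; rewrite asboolF.
Qed.

Lemma finite_partition (e : R) : 0 < e -> exists (K : nat) (cell : U -> 'I_K.+1) (cen : 'I_K.+1 -> U),
  (forall k, measurable ([set u | cell u = k] : set (borel U))) /\
  forall u, ball u e (cen (cell u)).
Proof.
move=> e0; pose B (c : U) : set U := (ball c e)^°.
have oB c : open (B c) by exact: open_interior.
have := cU; rewrite compact_cover => /(_ U setT B (fun c _ => oB c)) [].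
  by move=> u _; exists u => //; exact: (nbhsx_ballx u e e0).
move=> D _ cov; pose s : seq U := finmap.enum_fset D.
pose P u c := `[< B c u >].
have fs u : (find (P u) s < size s)%N.
  rewrite -has_find; have [c /= cD Bc] := cov u I; apply/hasP; exists c => //.
  exact/asboolP.
exists (size s), (fun u => inord (find (P u) s)), (fun k => nth point s k); split=> [k|u].
  rewrite (_ : [set _ | _] = [set u | find (P u) s = k]); first exact: measurable_find.
  apply/seteqP; split=> u /= => [<-|->]; last exact: inord_val.
  by rewrite inordK// ltnS ltnW.
rewrite inordK; last by rewrite ltnS ltnW.
have /asboolP : P u (nth point s (find (P u) s)) by apply: nth_find; rewrite has_find.
by move/interior_subset/ball_sym.
Qed.

Lemma measurable_cell K (cell : U -> 'I_K.+1) (g : 'I_K.+1 -> R) :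
  (forall k, measurable ([set u | cell u = k] : set (borel U))) ->
  measurable_fun [set: borel U] (fun u : borel U => g (cell u)).
Proof.
move=> mc.
rewrite (_ : (fun u => _) = (fun u => \sum_k g k * \1_[set u | cell u = k] u)).
  apply: measurable_sum => k; apply: measurable_funM; first exact: measurable_cst.
  exact: measurable_indic.
apply/funext => u; rewrite (bigD1 (cell u))//= big1 ?addr0.
  by rewrite indicE mem_set ?mulr1.
by move=> k kc; rewrite indicE memNset ?mulr0//= => e; rewrite e eqxx in kc.
Qed.

End FinitePartition.

(** In the following section Hm is minus the Hamiltonian, al x p u y the rate of
    the jumps from x to y at the minimizer, and F and G are read as functions of
    the density of the law. C bounds the values, hence 2 C bounds their
    gradients, and A the rates and the Lipschitz constant of Hm in this range. *)
Section Scheme.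
Context {R : realType} {d : nat} {U : pmetricType R}.
Local Notation S := (state d).
Local Notation vec := 'rV[R]_d.+1.
Hypothesis cU : compact [set: U].

Variables (T : R) (m0 : S -> U -> R) (Hm : S -> vec -> U -> R) (al : S -> vec -> U -> S -> R).
Variables (F G : S -> (S -> U -> R) -> U -> R) (A B CF CG C : R).
Hypotheses (T0 : 0 < T) (m0P : prob_vectors m0).
Hypotheses (C0 : 0 < C) (CE : CG + T * (B + CF) <= C) (A0 : 0 <= A) (B0 : 0 <= B).
Hypotheses (Fb : forall x q u, `|F x q u| <= CF) (Gb : forall x q u, `|G x q u| <= CG).

Definition bounded_vec (p : vec) := forall y : S, `|p ord0 y| <= 2 * C.

Hypotheses (al_ge0 : forall x p u y, 0 <= al x p u y)
  (al_le : forall x p u y, bounded_vec p -> al x p u y <= A)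
  (Hm_le : forall x p u, Hm x p u <= B)
  (Hm_ge : forall x p u, \sum_(y : S | y != x) al x p u y * p ord0 y - B <= Hm x p u)
  (Hm_lip : forall x p p' u, bounded_vec p -> bounded_vec p' ->
     `|Hm x p u - Hm x p' u| <= A * \sum_(y : S) `|p ord0 y - p' ord0 y|).

Definition bounded_om_continuous (f : vec -> U -> R) :=
  forall (p_ : nat -> vec) (u_ : nat -> U) (p : vec) (u : U),
  (forall n, bounded_vec (p_ n)) -> (forall y : S, p_ n ord0 y @[n --> om] --> p ord0 y) ->
  u_ @ om --> u -> f (p_ n) (u_ n) @[n --> om] --> f p u.

Definition uniform_density (F : S -> (S -> U -> R) -> U -> R) :=
  forall e : R, 0 < e -> exists2 dl : R, 0 < dl &
    forall x q q' u u', prob_vectors q -> prob_vectors q' ->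
      (forall y v, `|q y v - q' y v| <= dl) -> ball u dl u' ->
      `|F x q u - F x q' u'| <= e.

Hypotheses (al_cvg : forall x y, bounded_om_continuous (fun p u => al x p u y))
  (Hm_cvg : forall x, bounded_om_continuous (Hm x))
  (Fu : uniform_density F) (Gu : uniform_density G).

Definition jump (y : S) p u (x : S) : R :=
  if x == y then - \sum_(z : S | z != y) al y p u z else al y p u x.

Lemma jump_sum y p u : \sum_(x : S) jump y p u x = 0.
Proof.
rewrite (bigD1 y)//= {1}/jump eqxx addrC.
by rewrite (eq_bigr (fun x => al y p u x)) ?subrr// => x /negbTE xy; rewrite /jump xy.
Qed.

Lemma nabla_bounded (f : S -> R) x : (forall y, `|f y| <= C) -> bounded_vec (nabla f x).
Proof.
move=> fC y; rewrite mxE; apply: le_trans (ler_normB _ _) _.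
by rewrite mulr_natl mulr2n lerD.
Qed.

Section Step.
Variable h : R.
Hypotheses (h0 : 0 < h) (hA : h * (d.+1%:R * A) <= 1).

Lemma exit_le x p u : bounded_vec p -> h * \sum_(y : S | y != x) al x p u y <= 1.
Proof.
move=> pb; apply: le_trans hA; rewrite ler_pM2l//.
apply: (@le_trans _ _ (\sum_(y : S) A)); last by rewrite sumr_const card_ord mulr_natl.
by rewrite big_mkcond; apply: ler_sum => y _; case: ifP => // _; apply: al_le.
Qed.

(** The upper bound is that of Hm, due to the zero control. For the lower one,
    with s the transport term of [Hm_ge], w x + h s is a
    combination of the w y with nonnegative weights, because h times the exit rate
    is at most 1. *)
Lemma backward_step (w : S -> R) (b : R) x u f : (forall y, `|w y| <= C) -> (forall y, `|w y| <= b) ->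
  `|f| <= CF -> `|w x + h * (Hm x (nabla w x) u + f)| <= b + h * (B + CF).
Proof.
move=> wC wb fC; have pb := nabla_bounded x wC.
move: (fC) (wb x); rewrite !ler_norml => /andP[f1 f2] /andP[w1 w2].
apply/andP; split; last first.
  by apply: lerD => //; rewrite ler_pM2l// lerD.
have := Hm_ge x (nabla w x) u; set s := \sum_(y | _) _ => Hs.
have lo : - b <= w x + h * s.
  have -> : w x + h * s = (1 - h * \sum_(y : S | y != x) al x (nabla w x) u y) * w x
      + h * \sum_(y : S | y != x) al x (nabla w x) u y * w y.
    rewrite mulrBl mul1r -addrA; congr (_ + _); rewrite /s addrC -mulrA -mulrBr mulr_suml -sumrB.
    by congr (_ * _); apply: eq_bigr => y _; rewrite mxE mulrBr.
  have e1 := exit_le x u pb; set a := \sum_(y | _) _ in e1 *.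
  have l1 : (1 - h * a) * (- b) <= (1 - h * a) * w x by rewrite ler_wpM2l// subr_ge0.
  have l2 : h * (a * (- b)) <= h * \sum_(y : S | y != x) al x (nabla w x) u y * w y.
    rewrite ler_pM2l// mulr_suml; apply: ler_sum => y _; rewrite ler_wpM2l//.
    by have := wb y; rewrite ler_norml => /andP[].
  by apply: le_trans (lerD l1 l2); rewrite le_eqVlt; apply/orP; left; apply/eqP; ring.
have : h * (s - B) <= h * Hm x (nabla w x) u by rewrite ler_pM2l.
have : h * (- CF) <= h * f by rewrite ler_pM2l.
nra.
Qed.

Section Transition.
Variables (w : nat -> S -> R) (u : U).

(** The explicit Euler scheme for the Kolmogorov equation started at z. *)
Fixpoint trans (j : nat) (z x : S) : R :=
  if j is i.+1 then
    trans i z x + h * \sum_(y : S) trans i z y * jump y (nabla (w i) y) u x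
  else (z == x)%:R.

Hypothesis wC : forall j x, `|w j x| <= C.

Lemma trans_sum j z : \sum_(x : S) trans j z x = 1.
Proof.
elim: j => [|j IH] /=.
  by rewrite (bigD1 z)//= eqxx big1 ?addr0// => x /negbTE xz; rewrite eq_sym xz.
rewrite big_split/= IH -mulr_sumr exchange_big/= big1 ?mulr0 ?addr0// => y _.
by rewrite -mulr_sumr jump_sum mulr0.
Qed.

Lemma trans_ge0 j z x : 0 <= trans j z x.
Proof.
elim: j x => [|j IH] x /=; first by case: eqP.
rewrite (bigD1 x)//= {1}/jump eqxx mulrDr addrA addr_ge0//.
  rewrite mulrN mulrN mulrCA -[X in X - _]mulr1 -mulrBr mulr_ge0// subr_ge0.
  exact/exit_le/nabla_bounded.
rewrite mulr_ge0 ?(ltW h0)// sumr_ge0// => y yx; rewrite mulr_ge0//.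
by rewrite /jump eq_sym (negbTE yx).
Qed.

Lemma trans_le1 j z x : trans j z x <= 1.
Proof. by rewrite -(trans_sum j z) (bigD1 x)//= lerDl sumr_ge0// => y _; exact: trans_ge0. Qed.

End Transition.

Definition dens (W : nat -> S -> U -> R) (c : U -> U) j (x : S) (u : U) : R :=
  \sum_(z : S) m0 z u * trans (fun i y => W i y u) (c u) j z x.

(** The discrete system on n steps. The map c is meant to send a point of U to the
    centre of its cell; the two equations make W j x u a function of c u. *)
Record scheme (n : nat) (c : U -> U) (W : nat -> S -> U -> R) : Prop := Scheme {
  scheme_bound : forall j x u, `|W j x u| <= C ;
  scheme_density : forall j, prob_vectors (dens W c j) ;
  scheme_final : forall x u, W n x u = G x (dens W c n) (c u) ;
  scheme_step : forall j x u, (j < n)%N -> W j x u = W j.+1 x u +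
    h * (Hm x (nabla (fun y => W j.+1 y u) x) (c u) + F x (dens W c j.+1) (c u)) }.


Lemma dens_prob (W : nat -> S -> U -> R) (c : U -> U) j : (forall i y u, `|W i y u| <= C) ->
  (forall z x, measurable_fun [set: borel U]
     (fun u : borel U => trans (fun i y => W i y u) (c u) j z x)) ->
  prob_vectors (dens W c j).
Proof.
move=> WC mt; have [mm0 m00 m01] := m0P; split=> [x|x u|u].
- apply: measurable_sum => z; exact: measurable_funM.
- by apply: sumr_ge0 => z _; rewrite mulr_ge0// trans_ge0.
- rewrite /dens exchange_big/= -[RHS](m01 u); apply: eq_bigr => z _.
  by rewrite -mulr_sumr trans_sum mulr1.
Qed.

Lemma m0_average_dist (f g : S -> R) u (e : R) : (forall z, `|f z - g z| <= e) ->
  `|\sum_(z : S) m0 z u * f z - \sum_(z : S) m0 z u * g z| <= e.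
Proof.
move=> H; have [_ m00 m01] := m0P.
rewrite -sumrB; apply: le_trans (ler_norm_sum _ _ _) _.
rewrite -[e]mul1r -(m01 u) mulr_suml; apply: ler_sum => z _.
by rewrite -mulrBr normrM ger0_norm// ler_wpM2l.
Qed.

Section Continuity.
Variables (w_ : nat -> nat -> S -> R) (w : nat -> S -> R) (u : U).
Hypotheses (w_C : forall n j x, `|w_ n j x| <= C)
  (ww : forall j x, w_ n j x @[n --> om] --> w j x).

Lemma nabla_cvg j x (y : S) : nabla (w_ n j) x ord0 y @[n --> om] --> nabla (w j) x ord0 y.
Proof. by rewrite mxE; under eq_fun do rewrite mxE; apply: cvgB. Qed.

Lemma jump_cvg j y x :
  jump y (nabla (w_ n j) y) u x @[n --> om] --> jump y (nabla (w j) y) u x.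
Proof.
have ac z : al y (nabla (w_ n j) y) u z @[n --> om] --> al y (nabla (w j) y) u z.
  apply: (@al_cvg y z (fun n => nabla (w_ n j) y) (fun=> u)); last exact: cvg_cst.
    by move=> n; apply: nabla_bounded.
  by move=> ?; apply: nabla_cvg.
rewrite /jump; case: eqP => // _; apply: cvgN; apply: om_sum => z _; exact: ac.
Qed.

Lemma trans_cvg j z x : trans (w_ n) u j z x @[n --> om] --> trans w u j z x.
Proof.
elim: j x => [|j IH] x /=; first exact: cvg_cst.
apply: cvgD; first exact: IH.
apply: cvgM; first exact: cvg_cst.
by apply: om_sum => y _; apply: cvgM; [exact: IH|exact: jump_cvg].
Qed.

Lemma backward_cvg j x (f_ : nat -> R) f : f_ @ om --> f ->
  w_ n j x + h * (Hm x (nabla (w_ n j) x) u + f_ n) @[n --> om] -->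
  w j x + h * (Hm x (nabla (w j) x) u + f).
Proof.
move=> ff; apply: cvgD => //; apply: cvgM; first exact: cvg_cst.
apply: cvgD => //; apply: (@Hm_cvg x (fun n => nabla (w_ n j) x) (fun=> u)); last exact: cvg_cst.
  by move=> n; apply: nabla_bounded.
by move=> ?; apply: nabla_cvg.
Qed.

End Continuity.

Lemma uniform_density_cvg (f : S -> (S -> U -> R) -> U -> R) (q_ : nat -> S -> U -> R) q (s : nat -> R) x u :
  uniform_density f -> (forall n, prob_vectors (q_ n)) -> prob_vectors q ->
  (forall n y v, `|q_ n y v - q y v| <= s n) -> s @ om --> (0 : R) ->
  f x (q_ n) u @[n --> om] --> f x q u.
Proof.
move=> fu qP_ qP qq s0; apply/om_dist => e e0; have [dl dl0 H] := fu e e0.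
have := (om_dist _ _).1 s0 dl dl0; apply: filterS => n; rewrite subr0 => sd.
apply: H => //; last exact: ballxx.
by move=> y v; apply: le_trans (qq n y v) (le_trans (ler_norm _) sd).
Qed.

(** The unknowns are the values at the n + 1 times, in the states and in the
    cells. By backward induction the values obtained at step j are at most
    CG + (n - j) h (B + CF) <= C, so that the fixed point is not clipped. *)
Lemma scheme_exists n (e : R) : n%:R * h = T -> 0 < e ->
  exists c W, scheme n c W /\ forall u, ball u e (c u).
Proof.
move=> nh e0; have [K [cell [cen [mcell near_cen]]]] := finite_partition cU e0.
have CF0 : 0 <= CF by apply: le_trans (Fb ord0 m0 point).
have CG0 : 0 <= CG by apply: le_trans (Gb ord0 m0 point).
pose I : finType := ('I_n.+1 * S * 'I_K.+1)%type.
pose at_ (v : I -> R) k (j : nat) (x : S) : R := v (inord j, x, k).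
pose W (v : I -> R) j x u := at_ v (cell u) j x.
pose c u := cen (cell u).
pose cube := [set v : I -> R | forall i, `|v i| <= C].
have trans_cell v j z x u : trans (fun i y => W v i y u) (c u) j z x = trans (at_ v (cell u)) (cen (cell u)) j z x.
  by [].
have densP v j : cube v -> prob_vectors (dens (W v) c j).
  move=> vC; apply: dens_prob => [i y u|z x]; first exact: vC.
  exact: (measurable_cell (fun k => trans (at_ v k) (cen k) j z x) mcell).
pose inner (v : I -> R) (i : I) : R :=
  if val i.1.1 == n then G i.1.2 (dens (W v) c n) (cen i.2)
  else at_ v i.2 i.1.1.+1 i.1.2 + h * (Hm i.1.2 (nabla (at_ v i.2 i.1.1.+1) i.1.2) (cen i.2)
    + F i.1.2 (dens (W v) c i.1.1.+1) (cen i.2)).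
have [v vC vfix] : exists2 v, cube v & forall i, clip C (inner v i) = v i.
  apply: (@brouwer_cube R I C (fun v i => clip C (inner v i)) C0).
    by move=> v _ i; apply/clip_bound/ltW.
  move=> v_ v vC_ vC vv i; apply: om_clip.
  have dens_cvg (f : S -> (S -> U -> R) -> U -> R) j x u : uniform_density f ->
      f x (dens (W (v_ n)) c j) u @[n --> om] --> f x (dens (W v) c j) u.
    move=> fu; apply: (@uniform_density_cvg f _ _ (fun n => \sum_y \sum_z \sum_k
       `|trans (at_ (v_ n) k) (cen k) j z y - trans (at_ v k) (cen k) j z y|)) => //.
    - by move=> k; apply: densP; exact: vC_.
    - by apply: densP; exact: vC.
    - move=> k y u'; apply: m0_average_dist => z; rewrite !trans_cell.
      rewrite (bigD1 y)//= (bigD1 z)//= (bigD1 (cell u'))//= -!addrA lerDl.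
      by rewrite !addr_ge0 ?sumr_ge0// => ? _; rewrite ?sumr_ge0// => ? _; rewrite ?sumr_ge0.
    - apply: om_sum0 => y; apply: om_sum0 => z; apply: om_sum0 => k.
      rewrite -[X in _ --> X](@normr0 _ R); apply: cvg_norm.
      rewrite -[X in _ --> X](subrr (trans (at_ v k) (cen k) j z y)); apply: cvgB; last exact: cvg_cst.
      apply: (@trans_cvg (fun n => at_ (v_ n) k)) => *; [exact: vC_|exact: vv].
  rewrite /inner; case: ifP => _; first exact: dens_cvg.
  apply: (@backward_cvg (fun n => at_ (v_ n) i.2) (at_ v i.2)); last exact: dens_cvg.
  - by move=> *; apply: vC_.
  - by move=> *; apply: vv.
have key i : forall j x k, (j + i = n)%N -> v (inord j, x, k) = inner v (inord j, x, k) /\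
    `|v (inord j, x, k)| <= CG + i%:R * h * (B + CF).
  elim: i => [|i IH] j x k jn; have jn1 : (j < n.+1)%N by rewrite ltnS -jn leq_addr.
    have En : inner v (inord j, x, k) = G x (dens (W v) c n) (cen k).
      by rewrite /inner /= inordK// -[X in _ == X]jn addn0 eqxx.
    have E : v (inord j, x, k) = inner v (inord j, x, k); last first.
      by rewrite E En mul0r mul0r addr0.
    rewrite -[LHS]vfix clip_id// En.
    by apply: le_trans (Gb _ _ _) _; apply: le_trans CE; rewrite lerDl mulr_ge0 ?addr_ge0// ltW.
  have jn' : (j.+1 + i = n)%N by rewrite addSnnS.
  have jnF : (j == n) = false by rewrite -jn -[X in X == _]addn0 eqn_add2l.
  have le : `|inner v (inord j, x, k)| <= CG + i.+1%:R * h * (B + CF).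
    rewrite /inner /= inordK// jnF -[i.+1%:R]natr1 mulrDl mul1r mulrDl addrA.
    apply: backward_step => // [y|y]; first exact: vC.
    by have [_] := IH j.+1 y k jn'.
  have E : v (inord j, x, k) = inner v (inord j, x, k).
    rewrite -[LHS]vfix clip_id//; apply: le_trans le _; apply: le_trans CE.
    by rewrite lerD2l -nh ler_wpM2r ?addr_ge0// ler_wpM2r ?(ltW h0)// ler_nat -jn leq_addl.
  by split=> //; rewrite E.
exists c, (W v); split=> //; split=> [j x u|j|x u|j x u jn].
- exact: vC.
- exact: densP.
- have [e1 _] := key 0%N n x (cell u) (addn0 n).
  by rewrite [LHS]e1 /inner /= inordK ?ltnSn// eqxx.
- have [e1 _] := key (n - j)%N j x (cell u) (subnKC (ltnW jn)).
  by rewrite [LHS]e1 /inner /= inordK ?ltnS ?(ltnW jn)// ltn_eqF.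
Qed.

End Step.

(** * Estimates uniform in the discretization *)

(** By contradiction, as for [assumption2_uniform]: bounded vectors and points of
    U have limits along om. *)
Lemma bounded_uniform (f : vec -> U -> R) : bounded_om_continuous f ->
  forall e : R, 0 < e -> exists2 dl : R, 0 < dl &
    forall p p' u u', bounded_vec p -> bounded_vec p' ->
      (forall y : S, `|p ord0 y - p' ord0 y| <= dl) -> ball u dl u' -> `|f p u - f p' u'| <= e.
Proof.
move=> cf e e0; apply: contrapT => noe.
have bad n : exists a : (vec * vec) * (U * U),
    [/\ bounded_vec a.1.1, bounded_vec a.1.2,
     (forall y : S, `|a.1.1 ord0 y - a.1.2 ord0 y| <= n.+1%:R^-1),
     ball a.2.1 (n.+1%:R^-1) a.2.2 & ~ `|f a.1.1 a.2.1 - f a.1.2 a.2.2| <= e].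
  apply: contrapT => none; apply: noe; exists (n.+1%:R^-1) => // p p' u u' pb pb' pp uu.
  by apply: contrapT => H; apply: none; exists ((p, p'), (u, u')).
have [a Ha] := choice bad.
have [l ul] := om_point cU (fun n => (a n).2.1).
have ul' : (fun n => (a n).2.2) @ om --> l by apply: om_close ul _ => n; have [] := Ha n.
have pb n (y : S) : `|(a n).1.1 ord0 y| <= 2 * C by have [+ _ _ _ _] := Ha n; apply.
have [p0 Hp0] := choice (fun y => om_bounded (fun n => pb n y)).
pose p : vec := \row_y p0 y.
have pp (y : S) : (a n).1.1 ord0 y @[n --> om] --> p ord0 y by rewrite mxE; have [] := Hp0 y.
have pp' (y : S) : (a n).1.2 ord0 y @[n --> om] --> p ord0 y.
  have s0 : (a n).1.1 ord0 y - (a n).1.2 ord0 y @[n --> om] --> (0 : R).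
    by apply: om_squeeze0 (@om_harmonic R) => n; rewrite subr0; have [] := Ha n.
  rewrite -[X in _ --> X]subr0.
  rewrite (_ : (fun n => _) = (fun n => (a n).1.1 ord0 y - ((a n).1.1 ord0 y - (a n).1.2 ord0 y))); last first.
    by apply/funext => n; rewrite subKr.
  exact: cvgB.
have c1 := cf _ _ p l (fun n => let: And5 h _ _ _ _ := Ha n in h) pp ul.
have c2 := cf _ _ p l (fun n => let: And5 _ h _ _ _ := Ha n in h) pp' ul'.
have c12 : f (a n).1.1 (a n).2.1 - f (a n).1.2 (a n).2.2 @[n --> om] --> (0 : R).
  by rewrite -(subrr (f p l)); exact: cvgB.
have /filter_ex[n] := (om_dist _ _).1 c12 e e0; rewrite subr0.
by have [_ _ _ _] := Ha n.
Qed.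

Lemma Hm_uniform (e : R) : 0 < e -> exists2 dl : R, 0 < dl &
    forall x p p' u u', bounded_vec p -> bounded_vec p' ->
      (forall y : S, `|p ord0 y - p' ord0 y| <= dl) -> ball u dl u' ->
      `|Hm x p u - Hm x p' u'| <= e.
Proof.
move=> e0; apply: fin_delta => [x|x dl dl' dl0 le H p p' u u' pb pb' pp uu].
  exact: bounded_uniform.
apply: H => //; last exact: le_ball uu.
by move=> y; apply: le_trans (pp y) le.
Qed.

Lemma jump_uniform (e : R) : 0 < e -> exists2 dl : R, 0 < dl &
    forall x y p p' u u', bounded_vec p -> bounded_vec p' ->
      (forall y : S, `|p ord0 y - p' ord0 y| <= dl) -> ball u dl u' ->
      `|jump y p u x - jump y p' u' x| <= e.
Proof.
move=> e0; pose e1 := e / d.+1%:R.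
have e10 : 0 < e1 by rewrite divr_gt0.
have [dl dl0 H] : exists2 dl : R, 0 < dl &
    forall xy p p' u u', bounded_vec p -> bounded_vec p' ->
      (forall y : S, `|p ord0 y - p' ord0 y| <= dl) -> ball u dl u' ->
      `|al xy.1 p u xy.2 - al xy.1 p' u' xy.2| <= e1.
  apply: fin_delta => [[x y]|x dl dl' dl0 le H p p' u u' pb pb' pp uu] /=.
    exact: (bounded_uniform (@al_cvg x y)).
  apply: H => //; last exact: le_ball uu.
  by move=> y; apply: le_trans (pp y) le.
have e1e : e1 <= e by rewrite ler_pdivrMr// ler_peMr ?ler1n// ltW.
exists dl => // x y p p' u u' pb pb' pp uu; rewrite /jump; case: eqP => _; last first.
  by apply: le_trans e1e; exact: (H (y, x)).
rewrite opprK addrC -sumrB; apply: le_trans (ler_norm_sum _ _ _) _.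
rewrite (_ : e = \sum_(z : S) e1); last by rewrite sumr_const card_ord -mulr_natl mulrC divfK.
rewrite big_mkcond; apply: ler_sum => z _; case: ifP => _; last exact: ltW.
by rewrite distrC; exact: (H (y, z)).
Qed.

Lemma gronwall (a : nat -> R) (n : nat) (h k w : R) : 0 < h -> 0 <= k -> 0 <= w -> 0 <= a 0%N ->
  n%:R * h = T -> (forall j, (j < n)%N -> a j.+1 <= (1 + h * k) * a j + h * w) ->
  forall j, (j <= n)%N -> a j <= expR (k * T) * (a 0%N + T * w).
Proof.
move=> h0 k0 w0 a0 nh step j jn.
have hk : 1 <= 1 + h * k by rewrite lerDl mulr_ge0 ?(ltW h0).
have grow i : (i <= n)%N -> a i <= (1 + h * k) ^+ i * (a 0%N + i%:R * h * w).
  elim: i => [|i IH] lt; first by rewrite expr0 mul1r mul0r mul0r addr0.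
  apply: le_trans (step _ lt) _.
  have IH1 : (1 + h * k) * a i <= (1 + h * k) ^+ i.+1 * (a 0%N + i%:R * h * w).
    rewrite exprS -mulrA ler_pM2l; first exact: IH (ltnW lt).
    exact: lt_le_trans ltr01 hk.
  apply: le_trans (lerD IH1 (lexx _)) _; rewrite -[i.+1%:R]natr1.
  rewrite (_ : (i%:R + 1) * h * w = i%:R * h * w + h * w); last by ring.
  rewrite [a 0%N + (_ + _)]addrA [leRHS]mulrDr lerD2l.
  by rewrite ler_peMl ?exprn_ege1// mulr_ge0// ltW.
apply: le_trans (grow j jn) _; apply: ler_pM.
- by rewrite exprn_ge0// (le_trans _ hk).
- by rewrite addr_ge0// mulr_ge0// mulr_ge0// ltW.
- apply: (@le_trans _ _ (expR (h * k) ^+ j)).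
    by rewrite lerXn2r ?nnegrE ?(le_trans _ hk) ?expR_ge0//; exact: expR_ge1Dx.
  rewrite -expRM_natl ler_expR -nh (_ : j%:R * (h * k) = k * (j%:R * h)); last by ring.
  by rewrite ler_wpM2l// ler_pM2r// ler_nat.
- by rewrite lerD2l ler_wpM2r// -nh ler_wpM2r ?(ltW h0)// ler_nat.
Qed.

Let K1 : R := B + 2 * C * (d.+1%:R * A) + CF.
Let K2 : R := d.+1%:R * A.

Let CF0 : 0 <= CF. Proof. by apply: le_trans (Fb ord0 m0 point). Qed.
Let K20 : 0 <= K2. Proof. by rewrite mulr_ge0. Qed.
Let K10 : 0 <= K1.
Proof. by rewrite !addr_ge0// mulr_ge0// mulr_ge0// ltW. Qed.

Lemma Hm_bound x p u : bounded_vec p -> `|Hm x p u| <= B + 2 * C * K2.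
Proof.
move=> pb; have C20 : 0 <= 2 * C by rewrite mulr_ge0// ltW.
rewrite ler_norml; apply/andP; split; last first.
  by apply: le_trans (Hm_le _ _ _) _; rewrite lerDl mulr_ge0.
apply: le_trans (Hm_ge x p u); rewrite opprD addrC lerD2r.
have -> : - (2 * C * K2) = \sum_(y : S) - (A * (2 * C)).
  by rewrite sumr_const card_ord -mulr_natl /K2; ring.
rewrite [leRHS]big_mkcond; apply: ler_sum => y _; case: ifP => _; last by rewrite oppr_le0 mulr_ge0.
rewrite lerNl; apply: le_trans (ler_norm _) _; rewrite normrN normrM; apply: ler_pM => //.
by rewrite ger0_norm ?al_le.
Qed.

Lemma jump_bound y p u x : bounded_vec p -> `|jump y p u x| <= K2.
Proof.
move=> pb; have alA z : 0 <= al y p u z <= A by rewrite al_ge0 al_le.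
have sumK : \sum_(z : S | z != y) al y p u z <= K2.
  rewrite /K2 mulr_natl -[d.+1]card_ord -sumr_const big_mkcond; apply: ler_sum => z _.
  by case: ifP => // _; apply: al_le.
rewrite /jump; case: eqP => [_|/eqP xy]; first by rewrite normrN ger0_norm// sumr_ge0.
rewrite ger0_norm//; apply: le_trans sumK.
by rewrite (bigD1 x)//= lerDl sumr_ge0.
Qed.

Lemma nabla_dist (f g : S -> R) x (e : R) : (forall y, `|f y - g y| <= e) ->
  forall y : S, `|nabla f x ord0 y - nabla g x ord0 y| <= 2 * e.
Proof.
move=> fg y; rewrite !mxE; have := fg y; have := fg x.
rewrite !ler_norml => /andP[? ?] /andP[? ?]; apply/andP; split; lra.
Qed.

Section Estimates.
Variables (h : R) (n : nat) (c : U -> U) (W : nat -> S -> U -> R).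
Hypotheses (h0 : 0 < h) (hA : h * (d.+1%:R * A) <= 1) (nh : n%:R * h = T)
  (WS : scheme h n c W).

Let tr j u := trans h (fun i y => W i y u) (c u) j.
Let dn := dens h W c.
Let DW j u x := nabla (fun y => W j y u) x.

Lemma DW_bounded j u x : bounded_vec (DW j u x).
Proof. by apply: nabla_bounded => y; apply: scheme_bound WS _ _ _. Qed.

Lemma W_lipschitz i j x u : (i <= j <= n)%N ->
  `|W j x u - W i x u| <= (j%:R - i%:R) * h * K1.
Proof.
move=> /andP[ij jn]; elim: j ij jn => [|j IH] ij jn.
  by move: ij; rewrite leqn0 => /eqP ->; rewrite !subrr mul0r mul0r normr0.
move: ij; rewrite leq_eqVlt => /orP[/eqP ->|]; first by rewrite !subrr mul0r mul0r normr0.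
rewrite ltnS => ij; have {}IH := IH ij (ltnW jn).
have step : `|W j.+1 x u - W j x u| <= h * K1.
  rewrite (scheme_step WS x u jn) opprD addrA subrr add0r normrN normrM gtr0_norm// ler_pM2l//.
  apply: le_trans (ler_normD _ _) (lerD _ (Fb _ _ _)).
  exact: Hm_bound (DW_bounded _ _ _).
rewrite (_ : _ - _ = (W j.+1 x u - W j x u) + (W j x u - W i x u)); last by ring.
apply: le_trans (ler_normD _ _) _; apply: le_trans (lerD step IH) _.
by rewrite -[j.+1%:R]natr1; rewrite le_eqVlt; apply/orP; left; apply/eqP; ring.
Qed.

Lemma trans_lipschitz i j z x u : (i <= j)%N ->
  `|tr j u z x - tr i u z x| <= (j%:R - i%:R) * h * (d.+1%:R * K2).
Proof.
elim: j => [|j IH] ij.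
  by move: ij; rewrite leqn0 => /eqP ->; rewrite !subrr mul0r mul0r normr0.
move: ij; rewrite leq_eqVlt => /orP[/eqP ->|]; first by rewrite !subrr mul0r mul0r normr0.
rewrite ltnS => ij; have {}IH := IH ij.
have step : `|tr j.+1 u z x - tr j u z x| <= h * (d.+1%:R * K2).
  rewrite /tr /= addrAC subrr add0r normrM gtr0_norm// ler_pM2l//.
  apply: le_trans (ler_norm_sum _ _ _) _.
  rewrite [leRHS]mulr_natl -[d.+1]card_ord -sumr_const; apply: ler_sum => y _.
  rewrite normrM -[leRHS]mul1r ler_pM//; last exact: jump_bound (DW_bounded _ _ _).
  have tC i' y' : `|W i' y' u| <= C by apply: scheme_bound WS _ _ _.
  by rewrite ger0_norm; [apply: trans_le1|apply: trans_ge0].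
rewrite (_ : _ - _ = (tr j.+1 u z x - tr j u z x) + (tr j u z x - tr i u z x)); last by ring.
apply: le_trans (ler_normD _ _) _; apply: le_trans (lerD step IH) _.
by rewrite -[j.+1%:R]natr1; rewrite le_eqVlt; apply/orP; left; apply/eqP; ring.
Qed.

Lemma dens_lipschitz i j x u : (i <= j)%N ->
  `|dn j x u - dn i x u| <= (j%:R - i%:R) * h * (d.+1%:R * K2).
Proof. by move=> ij; apply: m0_average_dist => z; apply: trans_lipschitz. Qed.

Lemma W_time i j x u : (i <= n)%N -> (j <= n)%N ->
  `|W i x u - W j x u| <= `|i%:R - j%:R| * h * K1.
Proof.
move=> iN jN; have [ij|/ltnW ji] := leqP i j.
  rewrite distrC [X in X * h]distrC (@ger0_norm _ (j%:R - i%:R)) ?subr_ge0 ?ler_nat//.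
  by apply: W_lipschitz; rewrite ij.
by rewrite (@ger0_norm _ (i%:R - j%:R)) ?subr_ge0 ?ler_nat//; apply: W_lipschitz; rewrite ji.
Qed.

Lemma dens_time i j x u : `|dn i x u - dn j x u| <= `|i%:R - j%:R| * h * (d.+1%:R * K2).
Proof.
have [ij|/ltnW ji] := leqP i j.
  by rewrite distrC [X in X * h]distrC (@ger0_norm _ (j%:R - i%:R)) ?subr_ge0 ?ler_nat//; apply: dens_lipschitz.
by rewrite (@ger0_norm _ (i%:R - j%:R)) ?subr_ge0 ?ler_nat//; apply: dens_lipschitz.
Qed.

Lemma trans_01 j z x u : 0 <= tr j u z x <= 1.
Proof.
have tC i' y' : `|W i' y' u| <= C by apply: scheme_bound WS _ _ _.
by rewrite trans_ge0// trans_le1.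
Qed.

(** The densities follow the Kolmogorov scheme since it is linear. *)
Lemma dens_step j x u : dn j.+1 x u = dn j x u + h * \sum_(y : S) dn j y u * jump y (DW j u y) (c u) x.
Proof.
rewrite /dn /dens /=; under eq_bigr do rewrite mulrDr; rewrite big_split/=; congr (_ + _).
rewrite mulr_sumr; under [RHS]eq_bigr do rewrite mulr_suml mulr_sumr.
rewrite [RHS]exchange_big /=; apply: eq_bigr => z _.
by rewrite !mulr_sumr; apply: eq_bigr => y _; ring.
Qed.

Lemma dens0 x u : dn 0 x u = m0 x u.
Proof.
rewrite /dn /dens (bigD1 x)//= eqxx mulr1 big1 ?addr0// => z /negbTE zx.
by rewrite zx mulr0.
Qed.

End Estimates.

(** The differences between two cells, summed over the states, satisfy the
    hypothesis of [gronwall] in reversed time: F and G are uniformly continuous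
    in u with the same law, and Hm is Lipschitz in p. *)
Lemma W_equi (e : R) : 0 < e -> exists2 dl : R, 0 < dl &
  forall h n c W, 0 < h -> n%:R * h = T -> scheme h n c W ->
    forall u u', ball (c u) dl (c u') -> forall j x, (j <= n)%N ->
      `|W j x u - W j x u'| <= e.
Proof.
move=> e0; pose k : R := d.+1%:R * (d.+2%:R * A).
pose Q : R := expR (k * T) * (d.+1%:R * (1 + 2 * T)).
have Q0 : 0 < Q by rewrite mulr_gt0 ?expR_gt0// mulr_gt0// addr_gt0// mulr_gt0.
have e10 : 0 < e / Q by rewrite divr_gt0.
set e1 := e / Q in e10.
have [d1 d10 HH] := Hm_uniform e10; have [d2 d20 HF] := Fu e10; have [d3 d30 HG] := Gu e10.
exists (Num.min d1 (Num.min d2 d3)); first by rewrite !lt_min d10 d20.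
move=> h n c W h0 nh WS u u' uu j x jn.
have uu1 : ball (c u) d1 (c u') by apply: le_ball uu; rewrite ge_min lexx.
have uu2 : ball (c u) d2 (c u') by apply: le_ball uu; rewrite !ge_min lexx orbT.
have uu3 : ball (c u) d3 (c u') by apply: le_ball uu; rewrite !ge_min lexx !orbT.
pose D i := \sum_(x : S) `|W (n - i)%N x u - W (n - i)%N x u'|.
have Dx i x' : `|W (n - i)%N x' u - W (n - i)%N x' u'| <= D i.
  by rewrite /D (bigD1 x')//= lerDl sumr_ge0.
have D00 : D 0%N <= d.+1%:R * e1.
  rewrite mulr_natl -[d.+1]card_ord -sumr_const; apply: ler_sum => y _.
  rewrite subn0 !(scheme_final WS); apply: HG => //; try exact: (scheme_density WS).
  by move=> *; rewrite subrr normr0 ltW.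
have grow i : (i < n)%N -> D i.+1 <= (1 + h * k) * D i + h * (d.+1%:R * (2 * e1)).
  move=> lt; have E : (n - i = (n - i.+1).+1)%N by rewrite subnSK.
  have lt' : (n - i.+1 < n)%N by rewrite ltn_subrL /= (leq_ltn_trans _ lt).
  have term y : `|W (n - i.+1)%N y u - W (n - i.+1)%N y u'| <=
      `|W (n - i)%N y u - W (n - i)%N y u'| + h * (A * (d.+2%:R * D i) + 2 * e1).
    rewrite (scheme_step WS y u lt') (scheme_step WS y u' lt') -E.
    set p := nabla _ y; set p' := nabla _ y.
    have pb : bounded_vec p by apply: nabla_bounded => z; exact: (scheme_bound WS).
    have pb' : bounded_vec p' by apply: nabla_bounded => z; exact: (scheme_bound WS).
    set f := F _ _ _; set f' := F _ _ _.
    have ff : `|f - f'| <= e1.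
      apply: HF => //; try exact: (scheme_density WS).
      by move=> *; rewrite subrr normr0 ltW.
    have h1 : `|Hm y p (c u) - Hm y p' (c u)| <= A * (d.+2%:R * D i).
      apply: le_trans (Hm_lip y (c u) pb pb') _; rewrite ler_wpM2l//.
      rewrite -[d.+2%:R]natr1 mulrDl mul1r addrC.
      apply: (@le_trans _ _ (\sum_(z : S) (`|W (n - i)%N z u - W (n - i)%N z u'| + D i))).
        apply: ler_sum => z _; rewrite !mxE.
        apply: le_trans (_ : _ <= `|W (n - i)%N z u - W (n - i)%N z u'| + `|W (n - i)%N y u - W (n - i)%N y u'|) _.
          rewrite (_ : _ - _ = (W (n - i)%N z u - W (n - i)%N z u') - (W (n - i)%N y u - W (n - i)%N y u')); last by ring.
          exact: ler_normB.
        by rewrite lerD2l.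
      by rewrite big_split/= -/(D i) lerD2l sumr_const card_ord mulr_natl.
    have h2 : `|Hm y p' (c u) - Hm y p' (c u')| <= e1.
      by apply: HH => // z; rewrite subrr normr0 ltW.
    rewrite (_ : _ - _ = (W (n - i)%N y u - W (n - i)%N y u')
      + h * ((Hm y p (c u) - Hm y p' (c u)) + (Hm y p' (c u) - Hm y p' (c u')) + (f - f'))); last by ring.
    apply: le_trans (ler_normD _ _) _; rewrite lerD2l normrM gtr0_norm// ler_pM2l//.
    apply: le_trans (ler_normD _ _) _.
    apply: le_trans (lerD (le_trans (ler_normD _ _) (lerD h1 h2)) ff) _; lra.
  apply: le_trans (ler_sum _ (fun y _ => term y)) _.
  rewrite big_split/= sumr_const card_ord -[_ *+ _]mulr_natl /k.
  rewrite le_eqVlt; apply/orP; left; apply/eqP; rewrite -/(D i); ring.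
have k0 : 0 <= k by rewrite !mulr_ge0.
have w0 : 0 <= d.+1%:R * (2 * e1) by apply: mulr_ge0 => //; apply: mulr_ge0 => //; exact: ltW.
have a0 : 0 <= D 0%N by apply: sumr_ge0.
have := gronwall h0 k0 w0 a0 nh grow (leq_subr j n).
have := Dx (n - j)%N x; rewrite subKn// => le1 le2.
apply: le_trans le1 (le_trans le2 _).
apply: (@le_trans _ _ (expR (k * T) * (d.+1%:R * e1 + T * (d.+1%:R * (2 * e1))))).
  by rewrite ler_pM2l ?expR_gt0// lerD2r.
rewrite (_ : _ * _ = Q * e1); last by rewrite /Q; ring.
by rewrite /e1 mulrC divfK// gt_eqF.
Qed.

(** The forward analogue of [W_equi], the rates of nearby cells being close by
    [W_equi] and [jump_uniform]. *)
Lemma trans_equi (e : R) : 0 < e -> exists2 dl : R, 0 < dl &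
  forall h n c W, 0 < h -> h * (d.+1%:R * A) <= 1 -> n%:R * h = T -> scheme h n c W ->
    forall u u', ball (c u) dl (c u') -> forall j z x, (j <= n)%N ->
      `|trans h (fun i y => W i y u) (c u) j z x - trans h (fun i y => W i y u') (c u') j z x| <= e.
Proof.
move=> e0; pose k : R := d.+1%:R * K2.
pose Q : R := expR (k * T) * (T * (d.+1%:R * d.+1%:R)).
have Q0 : 0 < Q by rewrite mulr_gt0 ?expR_gt0// !mulr_gt0.
have e10 : 0 < e / Q by rewrite divr_gt0.
set e1 := e / Q in e10.
have [d1 d10 HJ] := jump_uniform e10.
have d12 : 0 < d1 / 2 by rewrite divr_gt0.
have [d2 d20 HW] := W_equi d12.
exists (Num.min d1 d2); first by rewrite lt_min d10 d20.
move=> h n c W h0 hA nh WS u u' uu j z x jn.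
have uu1 : ball (c u) d1 (c u') by apply: le_ball uu; rewrite ge_min lexx.
have uu2 : ball (c u) d2 (c u') by apply: le_ball uu; rewrite !ge_min lexx orbT.
pose t i := trans h (fun i y => W i y u) (c u) i z.
pose t' i := trans h (fun i y => W i y u') (c u') i z.
pose D i := \sum_(x : S) `|t i x - t' i x|.
have D00 : D 0%N = 0 by rewrite /D big1// => y _; rewrite subrr normr0.
have grow i : (i < n)%N -> D i.+1 <= (1 + h * k) * D i + h * (d.+1%:R * d.+1%:R * e1).
  move=> lt; have term y : `|t i.+1 y - t' i.+1 y| <=
      `|t i y - t' i y| + h * (K2 * D i + d.+1%:R * e1).
    rewrite /t /t' /= -/(t i) -/(t' i).
    set X := \sum_(_ : S) _; set X' := \sum_(_ : S) _.
    rewrite (_ : _ - _ = (t i y - t' i y) + h * (X - X')); last by ring.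
    apply: le_trans (ler_normD _ _) _; rewrite lerD2l normrM gtr0_norm// ler_pM2l//.
    rewrite -sumrB; apply: le_trans (ler_norm_sum _ _ _) _.
    rewrite mulr_sumr [d.+1%:R * e1]mulr_natl -[d.+1]card_ord -sumr_const -big_split/=.
    apply: ler_sum => v _.
    set J := jump _ _ _ _; set J' := jump _ _ _ _.
    have pb : bounded_vec (nabla (fun y => W i y u) v) by apply: nabla_bounded => w; exact: (scheme_bound WS).
    have pb' : bounded_vec (nabla (fun y => W i y u') v) by apply: nabla_bounded => w; exact: (scheme_bound WS).
    have JJ : `|J - J'| <= e1.
      apply: HJ => // w; rewrite -[d1](@divfK _ 2) // mulrC.
      by apply: nabla_dist => w'; apply: (HW h n c W) => //; exact: ltnW.
    have JK : `|J| <= K2 by exact: jump_bound.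
    rewrite (_ : _ - _ = J * (t i v - t' i v) + t' i v * (J - J')); last by ring.
    apply: le_trans (ler_normD _ _) _; rewrite !normrM; apply: lerD.
      exact: ler_wpM2r.
    have /andP[t0 t1] := trans_01 h0 hA WS i z v u'.
    by rewrite -[e1]mul1r; apply: ler_pM => //; rewrite ger0_norm.
  apply: le_trans (ler_sum _ (fun y _ => term y)) _.
  rewrite big_split/= sumr_const card_ord -[_ *+ _]mulr_natl /k.
  rewrite le_eqVlt; apply/orP; left; apply/eqP; rewrite -/(D i); ring.
have k0 : 0 <= k by rewrite mulr_ge0.
have w0 : 0 <= d.+1%:R * d.+1%:R * e1 by apply: mulr_ge0 => //; exact: ltW.
have a0 : 0 <= D 0%N by apply: sumr_ge0.
have le2 := gronwall h0 k0 w0 a0 nh grow jn.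
apply: (@le_trans _ _ (D j)); first by rewrite /D (bigD1 x)//= lerDl sumr_ge0.
apply: le_trans le2 _; rewrite D00 add0r (_ : _ * _ = Q * e1); last by rewrite /Q; ring.
by rewrite /e1 mulrC divfK// gt_eqF.
Qed.

Lemma backward_time (e : R) : 0 < e -> exists2 dl : R, 0 < dl &
  forall h n c W, 0 < h -> h * (d.+1%:R * A) <= 1 -> scheme h n c W ->
    forall u x i j, (i <= n)%N -> (j <= n)%N -> `|i%:R - j%:R| * h <= dl ->
    `|(Hm x (nabla (fun y => W i y u) x) (c u) + F x (dens h W c i) (c u)) -
      (Hm x (nabla (fun y => W j y u) x) (c u) + F x (dens h W c j) (c u))| <= e.
Proof.
move=> e0; have e2 : 0 < e / 2 by rewrite divr_gt0.
have [d1 d10 HH] := Hm_uniform e2; have [d2 d20 HF] := Fu e2.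
have K10' : 0 < K1 + 1 by rewrite ltr_wpDl.
have K20' : 0 < d.+1%:R * K2 + 1 by rewrite ltr_wpDl// mulr_ge0.
exists (Num.min (d1 / 2 / (K1 + 1)) (d2 / (d.+1%:R * K2 + 1))).
  by rewrite lt_min !divr_gt0.
move=> h n c W h0 hA WS u x i j iN jN; rewrite le_min => /andP[le1 le2].
have pb k : bounded_vec (nabla (fun y => W k y u) x) by apply: nabla_bounded => w; exact: (scheme_bound WS).
rewrite opprD addrACA (splitr e); apply: le_trans (ler_normD _ _) _; apply: lerD.
  apply: HH => // [y|]; last exact: ballxx.
  rewrite -[d1](@divfK _ 2) // mulrC; apply: nabla_dist => z.
  apply: le_trans (W_time h0 WS z u iN jN) _.
  move: le1; rewrite ler_pdivlMr//; apply: le_trans; rewrite ler_wpM2l ?lerDl//.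
  by apply: mulr_ge0 => //; exact: ltW.
apply: HF; try exact: (scheme_density WS); last exact: ballxx.
move=> y v; apply: le_trans (dens_time h0 hA WS _ _ _ _) _.
move: le2; rewrite ler_pdivlMr//; apply: le_trans; rewrite ler_wpM2l ?lerDl//.
by apply: mulr_ge0 => //; exact: ltW.
Qed.

Lemma forward_time (e : R) : 0 < e -> exists2 dl : R, 0 < dl &
  forall h n c W, 0 < h -> h * (d.+1%:R * A) <= 1 -> scheme h n c W ->
    forall u x i j, (i <= n)%N -> (j <= n)%N -> `|i%:R - j%:R| * h <= dl ->
    `|\sum_(y : S) dens h W c i y u * jump y (nabla (fun z => W i z u) y) (c u) x -
      \sum_(y : S) dens h W c j y u * jump y (nabla (fun z => W j z u) y) (c u) x| <= e.
Proof.
move=> e0; pose e1 := e / d.+1%:R / 2.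
have e10 : 0 < e1 by rewrite !divr_gt0.
have [d1 d10 HJ] := jump_uniform e10.
have K10' : 0 < K1 + 1 by rewrite ltr_wpDl.
have K20' : 0 < d.+1%:R * K2 * K2 + 1 by rewrite ltr_wpDl// !mulr_ge0.
exists (Num.min (d1 / 2 / (K1 + 1)) (e1 / (d.+1%:R * K2 * K2 + 1))).
  by rewrite lt_min !divr_gt0.
move=> h n c W h0 hA WS u x i j iN jN; rewrite le_min => /andP[le1 le2].
have dif0 : 0 <= `|i%:R - j%:R : R| * h by rewrite mulr_ge0// ltW.
rewrite -sumrB; apply: le_trans (ler_norm_sum _ _ _) _.
rewrite (_ : e = \sum_(y : S) (e1 + e1)); last first.
  by rewrite sumr_const card_ord -mulr_natl /e1 -splitr mulrC divfK.
apply: ler_sum => y _; set J := jump _ _ _ _; set J' := jump _ _ _ _.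
have pb k : bounded_vec (nabla (fun z => W k z u) y) by apply: nabla_bounded => w; exact: (scheme_bound WS).
have JJ : `|J - J'| <= e1.
  apply: HJ => // [w|]; last exact: ballxx.
  rewrite -[d1](@divfK _ 2) // mulrC; apply: nabla_dist => z.
  apply: le_trans (W_time h0 WS z u iN jN) _.
  by move: le1; rewrite ler_pdivlMr//; apply: le_trans; rewrite ler_wpM2l ?lerDl.
have JK : `|J| <= K2 by exact: jump_bound.
set q := dens _ _ _ i y u; set q' := dens _ _ _ j y u.
rewrite (_ : _ - _ = J * (q - q') + q' * (J - J')); last by ring.
apply: le_trans (ler_normD _ _) _; rewrite !normrM; apply: lerD.
  apply: (@le_trans _ _ (K2 * (`|i%:R - j%:R| * h * (d.+1%:R * K2)))).
    by apply: ler_pM => //; exact: (dens_time h0 hA WS).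
  move: le2; rewrite ler_pdivlMr//; apply: le_trans.
  rewrite mulrCA ler_wpM2l//; rewrite (_ : K2 * _ = d.+1%:R * K2 * K2) ?lerDl//; ring.
have qP := scheme_density WS j; have [_ q0 _] := qP.
rewrite -[e1]mul1r; apply: ler_pM => //; rewrite ger0_norm; last exact: q0.
exact: (prob_vectors_le1 y u qP).
Qed.

(** * Passage to the limit *)

(** The number of steps in the N-th scheme exceeds T (d + 1) A, as stability
    requires. *)
Lemma schemes_exist : exists n_ c_ W_, forall N,
  let h := T / (n_ N)%:R in
  [/\ 0 < h, h * (d.+1%:R * A) <= 1, (n_ N)%:R * h = T, h <= T / N.+1%:R &
   scheme h (n_ N) (c_ N) (W_ N) /\ forall u, ball u N.+1%:R^-1 (c_ N u)].
Proof.
pose N0 := Num.truncn (T * (d.+1%:R * A)).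
suff H N : exists a : nat * ((U -> U) * (nat -> S -> U -> R)), let h := T / a.1%:R in
  [/\ 0 < h, h * (d.+1%:R * A) <= 1, a.1%:R * h = T, h <= T / N.+1%:R &
   scheme h a.1 a.2.1 a.2.2 /\ forall u, ball u N.+1%:R^-1 (a.2.1 u)].
  have [a Ha] := choice H.
  by exists (fun N => (a N).1), (fun N => (a N).2.1), (fun N => (a N).2.2).
pose n := (N0 + N).+1.
have n0 : 0 < n%:R :> R by rewrite ltr0n.
have h0 : 0 < T / n%:R by rewrite divr_gt0.
have hA : T / n%:R * (d.+1%:R * A) <= 1.
  rewrite mulrAC ler_pdivrMr// mul1r; apply/ltW/lt_le_trans; first exact: truncnS_gt.
  by rewrite ler_nat ltnS leq_addr.
have nh : n%:R * (T / n%:R) = T by rewrite mulrC divfK// gt_eqF.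
have r0 : 0 < N.+1%:R^-1 :> R by rewrite invr_gt0.
have [c [W [WS cu]]] := scheme_exists h0 hA nh r0.
exists (n, (c, W)); split=> //.
by rewrite ler_pM2l// lef_pV2 ?posrE// ler_nat ltnS leq_addl.
Qed.

Section Limit.
Variables (n_ : nat -> nat) (c_ : nat -> U -> U) (W_ : nat -> nat -> S -> U -> R).
Let h_ N : R := T / (n_ N)%:R.
Hypotheses (h0 : forall N, 0 < h_ N) (hA : forall N, h_ N * (d.+1%:R * A) <= 1)
  (nh : forall N, (n_ N)%:R * h_ N = T) (hN : forall N, h_ N <= T / N.+1%:R)
  (WS : forall N, scheme (h_ N) (n_ N) (c_ N) (W_ N))
  (cu : forall N u, ball u N.+1%:R^-1 (c_ N u)).

Let tr N j u := trans (h_ N) (fun i y => W_ N i y u) (c_ N u) j.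
Let dn N := dens (h_ N) (W_ N) (c_ N).

(** The index of the last grid time not later than t. *)
Definition idx N (t : R) := Num.truncn (t / h_ N).

Lemma h_cvg : h_ @ om --> (0 : R).
Proof.
apply: (@om_squeeze0 R _ (fun N => T * N.+1%:R^-1)) => [N|].
  by rewrite subr0 gtr0_norm.
by rewrite -(mulr0 T); apply: cvgM; [exact: cvg_cst|exact: om_harmonic].
Qed.

Lemma h_small (r : R) : 0 < r -> \forall N \near om, h_ N <= r.
Proof.
move=> r0; have := (om_dist _ _).1 h_cvg r r0; apply: filterS => N.
by rewrite subr0 gtr0_norm.
Qed.

Lemma harmonic_small (r : R) : 0 < r -> \forall N \near om, N.+1%:R^-1 <= r.
Proof.
move=> r0; have := (om_dist _ _).1 (@om_harmonic R) r r0; apply: filterS => N.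
by rewrite subr0 ger0_norm.
Qed.

Lemma idx_le N t : 0 <= t <= T -> (idx N t <= n_ N)%N.
Proof.
move=> /andP[t0 tT]; rewrite -(natrK (R := R) (n_ N)); apply: le_truncn.
by rewrite ler_pdivrMr// nh.
Qed.

Lemma idx_itv N t : 0 <= t <= T -> t - h_ N <= (idx N t)%:R * h_ N <= t.
Proof.
move=> /andP[t0 tT]; have th : 0 <= t / h_ N by rewrite divr_ge0// ltW.
have /andP[h1 h2] := truncn_itv th.
move: h1 h2; rewrite -natr1 ler_pdivlMr// ltr_pdivrMr// mulrDl mul1r => h1 h2.
by rewrite -/(idx N t) in h1 h2 *; rewrite h1 andbT lerBlDr ltW.
Qed.

Lemma idx_dist N s t : 0 <= s <= T -> 0 <= t <= T ->
  `|((idx N s)%:R - (idx N t)%:R) * h_ N - (s - t)| <= h_ N.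
Proof.
move=> /(idx_itv N)/andP[s1 s2] /(idx_itv N)/andP[t1 t2].
by rewrite mulrBl ler_norml; apply/andP; split; lra.
Qed.

Lemma idx0 N : idx N 0 = 0%N.
Proof. by rewrite /idx mul0r truncn0. Qed.

Lemma idxT N : idx N T = n_ N.
Proof. by rewrite /idx -{1}(nh N) mulfK ?natrK// gt_eqF. Qed.

(** Summing the increments between the grid indices of t and s gives
    w s - w t = (s - t) l up to e |s - t| and an error of order h, which
    vanishes in the limit. *)
Lemma limit_derivative (w_ g_ : nat -> nat -> R) (w : R -> R) (K t l : R) :
  (forall e : R, 0 < e -> exists2 dl : R, 0 < dl & forall N i k, (i <= n_ N)%N -> (k < n_ N)%N ->
     `|k%:R - i%:R| * h_ N <= dl -> `|k.+1%:R - i%:R| * h_ N <= dl ->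
     `|w_ N k.+1 - w_ N k - h_ N * g_ N i| <= h_ N * e) ->
  (forall N i, `|g_ N i| <= K) ->
  (forall s, 0 <= s <= T -> w_ N (idx N s) @[N --> om] --> w s) ->
  g_ N (idx N t) @[N --> om] --> l -> 0 <= t <= T -> has_derivative T w t l.
Proof.
move=> step gK wlim glim tT.
have key (e : R) : 0 < e -> exists2 dl : R, 0 < dl & forall s, 0 <= s <= T -> `|s - t| <= dl ->
    `|w s - w t - (s - t) * l| <= e * `|s - t|.
  move=> e0; have [dl dl0 H] := step e e0.
  have dl2 : 0 < dl / 2 by rewrite divr_gt0.
  exists (dl / 2) => // s sT st.
  have tele N i a b : (i <= n_ N)%N -> (a <= b <= n_ N)%N ->
      (forall k, (a <= k <= b)%N -> `|k%:R - i%:R| * h_ N <= dl) ->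
      `|w_ N b - w_ N a - (b%:R - a%:R) * h_ N * g_ N i| <= (b%:R - a%:R) * h_ N * e.
    move=> iN /andP[ab bN]; elim: b ab bN => [|b IH] ab bN close.
      by move: ab; rewrite leqn0 => /eqP ->; rewrite !subrr !mul0r subrr normr0.
    move: ab; rewrite leq_eqVlt => /orP[/eqP ->|]; first by rewrite !subrr !mul0r subrr normr0.
    rewrite ltnS => ab.
    have IH' : `|w_ N b - w_ N a - (b%:R - a%:R) * h_ N * g_ N i| <= (b%:R - a%:R) * h_ N * e.
      by apply: IH => // [|k /andP[ak kb]]; [exact: ltnW|apply: close; rewrite ak leqW].
    have c1 : `|b%:R - i%:R| * h_ N <= dl by apply: close; rewrite ab leqnSn.
    have c2 : `|b.+1%:R - i%:R| * h_ N <= dl by apply: close; rewrite leqW//= leqnn.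
    have st1 := H N i b iN bN c1 c2.
    rewrite -[b.+1%:R]natr1 (_ : _ - _ = (w_ N b.+1 - w_ N b - h_ N * g_ N i) +
      (w_ N b - w_ N a - (b%:R - a%:R) * h_ N * g_ N i)); last by ring.
    apply: le_trans (ler_normD _ _) _; apply: le_trans (lerD st1 IH') _.
    by rewrite le_eqVlt; apply/orP; left; apply/eqP; ring.
  have tele2 N i j : (i <= n_ N)%N -> (j <= n_ N)%N -> `|j%:R - i%:R| * h_ N <= dl ->
      `|w_ N j - w_ N i - (j%:R - i%:R) * h_ N * g_ N i| <= `|j%:R - i%:R| * h_ N * e.
    move=> iN jN close; have [ij|/ltnW ji] := leqP i j.
      rewrite ger0_norm ?subr_ge0 ?ler_nat// in close *.
      apply: tele => // [|k /andP[ik kj]]; first by rewrite ij.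
      rewrite ger0_norm ?subr_ge0 ?ler_nat//; apply: le_trans close.
      by rewrite ler_pM2r// lerD2r ler_nat.
    rewrite [`|j%:R - _|]ler0_norm ?subr_le0 ?ler_nat// opprB in close *.
    have := tele N i j i iN; rewrite ji iN => /(_ isT).
    rewrite (_ : w_ N i - w_ N j - _ = - (w_ N j - w_ N i - (j%:R - i%:R) * h_ N * g_ N i)); last by ring.
    rewrite normrN; apply => k /andP[jk ki].
    rewrite ler0_norm ?subr_le0 ?ler_nat// opprB; apply: le_trans close.
    by rewrite ler_pM2r// lerD2l lerN2 ler_nat.
  have evt : \forall N \near om, `|w_ N (idx N s) - w_ N (idx N t) - (s - t) * g_ N (idx N t)|
      <= e * `|s - t| + h_ N * (e + K).
    apply: filterS (h_small dl2) => N hdl.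
    have dist := idx_dist N sT tT; set D := (_ - _) * h_ N in dist.
    have D1 : `|(idx N s)%:R - (idx N t)%:R| * h_ N <= `|s - t| + h_ N.
      rewrite -[h_ N in X in X <= _](gtr0_norm (h0 N)) -normrM -/D.
      rewrite (_ : D = (D - (s - t)) + (s - t)); last by ring.
      by apply: le_trans (ler_normD _ _) _; rewrite addrC lerD2l.
    have D2 : `|(idx N s)%:R - (idx N t)%:R| * h_ N <= dl.
      by apply: le_trans D1 _; rewrite (splitr dl) lerD.
    have := tele2 N _ _ (idx_le N tT) (idx_le N sT) D2; rewrite -/D => T1.
    rewrite (_ : _ - _ = (w_ N (idx N s) - w_ N (idx N t) - D * g_ N (idx N t))
      + (D - (s - t)) * g_ N (idx N t)); last by ring.
    apply: le_trans (ler_normD _ _) _.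
    have T2 : `|(D - (s - t)) * g_ N (idx N t)| <= h_ N * K by rewrite normrM ler_pM.
    have T3 : `|(idx N s)%:R - (idx N t)%:R| * h_ N * e <= (`|s - t| + h_ N) * e by rewrite ler_wpM2r// ltW.
    apply: le_trans (lerD (le_trans T1 T3) T2) _.
    by rewrite le_eqVlt; apply/orP; left; apply/eqP; ring.
  have lhs : `|w_ N (idx N s) - w_ N (idx N t) - (s - t) * g_ N (idx N t)| @[N --> om]
      --> `|w s - w t - (s - t) * l|.
    apply: cvg_norm; apply: cvgB; first by apply: cvgB; exact: wlim.
    by apply: cvgM; [exact: cvg_cst|exact: glim].
  have rhs : e * `|s - t| + h_ N * (e + K) @[N --> om] --> e * `|s - t| + 0 * (e + K).
    by apply: cvgD; [exact: cvg_cst|apply: cvgM; [exact: h_cvg|exact: cvg_cst]].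
  rewrite mul0r addr0 in rhs.
  exact: (ler_cvg_to lhs rhs evt).
apply/cvgrPdist_le => e e0; have [dl dl0 H] := key e e0.
rewrite near_withinE /dnbhs near_withinE; apply/nbhs_ballP; exists dl => //= s.
rewrite /ball_ => ts sneq; rewrite in_itv/= => sT.
have st0 : 0 < `|s - t| by rewrite normr_gt0 subr_eq0.
have nz : s - t != 0 by rewrite subr_eq0.
rewrite -(ler_pM2r st0); apply: le_trans (H s sT _); last by rewrite distrC ltW.
rewrite -normrM mulrBl divfK// -normrN opprB mulrC.
done.
Qed.

Definition value t x u : R := lim (W_ N (idx N t) x u @[N --> om]).
Definition propagator t z x u : R := lim (tr N (idx N t) u z x @[N --> om]).
Definition density t x u : R := \sum_(z : S) m0 z u * propagator t z x u.
Let DV t x u : vec := nabla (fun y => value t y u) x.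
Let DW N j x u : vec := nabla (fun y => W_ N j y u) x.

Lemma value_cvg t x u : W_ N (idx N t) x u @[N --> om] --> value t x u.
Proof.
have [N|l [_ Wl]] := @om_bounded R (fun N => W_ N (idx N t) x u) C.
  exact: (scheme_bound (WS N)).
by rewrite /value (cvg_lim _ Wl).
Qed.

Lemma propagator_cvg t z x u : tr N (idx N t) u z x @[N --> om] --> propagator t z x u.
Proof.
have [N|l [_ tl]] := @om_bounded R (fun N => tr N (idx N t) u z x) 1.
  by have /andP[t0 t1] := trans_01 (h0 N) (@hA N) (WS N) (idx N t) z x u; rewrite ger0_norm.
by rewrite /propagator (cvg_lim _ tl).
Qed.

Lemma density_cvg t x u : dn N (idx N t) x u @[N --> om] --> density t x u.
Proof.
by apply: om_sum => z _; apply: cvgM; [exact: cvg_cst|exact: propagator_cvg].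
Qed.

Lemma grad_cvg t x u (y : S) : DW N (idx N t) x u ord0 y @[N --> om] --> DV t x u ord0 y.
Proof. by rewrite mxE; under eq_fun do rewrite mxE; apply: cvgB; exact: value_cvg. Qed.

Lemma grad_bounded N j x u : bounded_vec (DW N j x u).
Proof. by apply: nabla_bounded => y; exact: (scheme_bound (WS N)). Qed.

Lemma center_cvg u : c_ N u @[N --> om] --> u.
Proof.
by apply: (om_close (u := fun=> u) (v := fun N => c_ N u)); [exact: cvg_cst|move=> N; exact: cu].
Qed.

Lemma Hm_limit t x u : Hm x (DW N (idx N t) x u) (c_ N u) @[N --> om] --> Hm x (DV t x u) u.
Proof.
apply: (@Hm_cvg x (fun N => DW N (idx N t) x u) (fun N => c_ N u)).
- by move=> N; exact: grad_bounded.
- by move=> y; exact: grad_cvg.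
- exact: center_cvg.
Qed.

Lemma jump_limit t y x u : jump y (DW N (idx N t) y u) (c_ N u) x @[N --> om] --> jump y (DV t y u) u x.
Proof.
have ac z : al y (DW N (idx N t) y u) (c_ N u) z @[N --> om] --> al y (DV t y u) u z.
  apply: (@al_cvg y z (fun N => DW N (idx N t) y u) (fun N => c_ N u)).
  - by move=> N; exact: grad_bounded.
  - by move=> v; exact: grad_cvg.
  - exact: center_cvg.
rewrite /jump; case: eqP => // _; apply: cvgN; apply: om_sum => z _; exact: ac.
Qed.

(** The centres of the cells of u and u' are within the mesh from u and u', and
    the mesh is eventually small compared with r. *)
Lemma trans_equi_near (e : R) : 0 < e -> exists2 r : R, 0 < r &
  \forall N \near om, forall t u u' z x, 0 <= t <= T -> ball u r u' ->
    `|tr N (idx N t) u z x - tr N (idx N t) u' z x| <= e.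
Proof.
move=> e0; have [dl dl0 H] := trans_equi e0.
have dl3 : 0 < dl / 3 by rewrite divr_gt0.
exists (dl / 3) => //; apply: filterS (harmonic_small dl3) => N hdl t u u' z x tT uu.
apply: (H (h_ N) (n_ N) (c_ N) (W_ N)) => //; last exact: idx_le.
have b1 : ball (c_ N u) (dl / 3) u by apply/ball_sym; apply: le_ball (cu N u).
have b2 : ball u' (dl / 3) (c_ N u') by apply: le_ball (cu N u').
rewrite (_ : dl = dl / 3 + dl / 3 + dl / 3); last by field.
exact: ball_triangle (ball_triangle b1 uu) b2.
Qed.

Lemma propagator_uniform (e : R) : 0 < e -> exists2 r : R, 0 < r &
  forall t u u' z x, 0 <= t <= T -> ball u r u' ->
    `|propagator t z x u - propagator t z x u'| <= e.
Proof.
move=> e0; have [r r0 H] := trans_equi_near e0; exists r => // t u u' z x tT uu.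
have lhs : `|tr N (idx N t) u z x - tr N (idx N t) u' z x| @[N --> om] -->
    `|propagator t z x u - propagator t z x u'|.
  by apply: cvg_norm; apply: cvgB; exact: propagator_cvg.
have rhs : (fun=> e) @ om --> e by exact: cvg_cst.
apply: (ler_cvg_to lhs rhs).
by apply: filterS H => N; apply.
Qed.

Lemma propagator_continuous t z x : 0 <= t <= T -> continuous (propagator t z x).
Proof.
move=> tT u; apply/cvgrPdist_le => e e0; have [r r0 H] := propagator_uniform e0.
by apply/nbhs_ballP; exists r => //= u' uu; apply: H.
Qed.

Lemma density_prob t : 0 <= t <= T -> prob_vectors (density t).
Proof.
move=> tT; have [mm0 m00 m01] := m0P; split=> [x|x u|u].
- apply: measurable_sum => z; apply: measurable_funM => //.
  exact: (borel_continuous (@propagator_continuous t z x tT)).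
- suff : (0 : R) <= density t x u by [].
  apply: (@om_le R (fun=> 0) (fun N => dn N (idx N t) x u) 0 (density t x u)); [exact: cvg_cst|exact: density_cvg|move=> N].
  by have [_ q0 _] := scheme_density (WS N) (idx N t); exact: q0.
- have c : \sum_(x : S) dn N (idx N t) x u @[N --> om] --> \sum_(x : S) density t x u.
    by apply: om_sum => x _; exact: density_cvg.
  apply: om_unique c _; under eq_fun => N.
    have [_ _ ->] := scheme_density (WS N) (idx N t); over.
  exact: cvg_cst.
Qed.

(** Pointwise convergence at the finitely many centres of a partition is extended
    to all u by equicontinuity. *)
Lemma propagator_uniform_cvg t (e : R) : 0 <= t <= T -> 0 < e ->
  \forall N \near om, forall u z x, `|tr N (idx N t) u z x - propagator t z x u| <= e.
Proof.
move=> tT e0; have e3 : 0 < e / 3 by rewrite divr_gt0.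
have [r1 r10 H1] := trans_equi_near e3; have [r2 r20 H2] := propagator_uniform e3.
have r0 : 0 < Num.min r1 r2 by rewrite lt_min r10.
have [K [cell [cen [_ near_cen]]]] := finite_partition cU r0.
have fin : \forall N \near om, forall a : 'I_K.+1 * (S * S),
    `|tr N (idx N t) (cen a.1) a.2.1 a.2.2 - propagator t a.2.1 a.2.2 (cen a.1)| <= e / 3.
  apply: filter_forall => -[k [z x]] /=.
  exact: ((om_dist (fun N => tr N (idx N t) (cen k) z x) _).1 (@propagator_cvg t z x (cen k)) _ e3).
apply: filterS2 H1 fin => N H1 fin u z x.
have b1 : ball u r1 (cen (cell u)) by apply: le_ball (near_cen u); rewrite ge_min lexx.
have b2 : ball u r2 (cen (cell u)) by apply: le_ball (near_cen u); rewrite ge_min lexx orbT.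
have := H1 t _ _ z x tT b1; have := fin (cell u, (z, x)); have := H2 t _ _ z x tT b2.
rewrite /= !ler_norml => /andP[? ?] /andP[? ?] /andP[? ?]; apply/andP; split; lra.
Qed.

(** The densities converge uniformly in u by [propagator_uniform_cvg], and f is
    controlled by the sup distance of densities. *)
Lemma functional_limit (f : S -> (S -> U -> R) -> U -> R) t x u : uniform_density f -> 0 <= t <= T ->
  f x (dn N (idx N t)) (c_ N u) @[N --> om] --> f x (density t) u.
Proof.
move=> fu tT; apply/om_dist => e e0; have [dl dl0 H] := fu e e0.
apply: filterS2 (harmonic_small dl0) (propagator_uniform_cvg tT dl0) => N hdl close.
rewrite distrC; apply: H.
- exact: density_prob.
- exact: (scheme_density (WS N)).
- by move=> y v; rewrite distrC; apply: m0_average_dist => z; exact: close.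
- by apply: le_ball (cu N u).
Qed.

Lemma value_final x u : value T x u = G x (density T) u.
Proof.
have TT : 0 <= T <= T by rewrite ltW/=.
have c : W_ N (idx N T) x u @[N --> om] --> G x (density T) u.
  under eq_fun => N do rewrite idxT (scheme_final (WS N)) -(idxT N).
  exact: functional_limit.
exact: (om_unique (@value_cvg T x u) c).
Qed.

Lemma density_init x u : density 0 x u = m0 x u.
Proof.
have c : dn N (idx N 0) x u @[N --> om] --> m0 x u.
  by under eq_fun => N do rewrite idx0 /dn dens0; exact: cvg_cst.
exact: (om_unique (@density_cvg 0 x u) c).
Qed.

Lemma value_derivative t x u : 0 <= t <= T ->
  has_derivative T (fun s => value s x u) t (- (Hm x (DV t x u) u + F x (density t) u)).
Proof.
move=> tT.
apply: (@limit_derivative (fun N j => W_ N j x u) (fun N j =>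
  - (Hm x (DW N j x u) (c_ N u) + F x (dn N j) (c_ N u))) _ (B + 2 * C * K2 + CF)) => //.
- move=> e e0; have [dl dl0 H] := backward_time e0; exists dl => // N i k iN kN _ close.
  rewrite (scheme_step (WS N) x u kN).
  set X' := Hm _ _ _ + F _ _ _; set X := Hm _ _ _ + F _ _ _.
  rewrite (_ : _ - _ = h_ N * (X - X')); last by ring.
  rewrite normrM gtr0_norm// ler_pM2l// distrC.
  by apply: (H (h_ N) (n_ N) (c_ N) (W_ N)).
- move=> N i; rewrite normrN; apply: le_trans (ler_normD _ _) (lerD _ (Fb _ _ _)).
  exact/Hm_bound/grad_bounded.
- by move=> s _; exact: value_cvg.
- by apply: cvgN; apply: cvgD; [exact: Hm_limit|exact: functional_limit].
Qed.

Lemma density_derivative t x u : 0 <= t <= T ->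
  has_derivative T (fun s => density s x u) t
    (\sum_(y : S) density t y u * jump y (DV t y u) u x).
Proof.
move=> tT.
apply: (@limit_derivative (fun N j => dn N j x u) (fun N j =>
  \sum_(y : S) dn N j y u * jump y (DW N j y u) (c_ N u) x) _ (d.+1%:R * K2)) => //.
- move=> e e0; have [dl dl0 H] := forward_time e0; exists dl => // N i k iN kN close _.
  rewrite /dn dens_step -/(dn N); set X := \sum_(_ : S) _; set X' := \sum_(_ : S) _.
  rewrite (_ : _ - _ = h_ N * (X - X')); last by ring.
  rewrite normrM gtr0_norm// ler_pM2l//.
  by apply: (H (h_ N) (n_ N) (c_ N) (W_ N)) => //; exact: ltnW.
- move=> N i; apply: le_trans (ler_norm_sum _ _ _) _.
  rewrite mulr_natl -[d.+1]card_ord -sumr_const; apply: ler_sum => y _.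
  have qP := scheme_density (WS N) i; have [_ q0 _] := qP.
  rewrite normrM -[leRHS]mul1r; apply: ler_pM => //; last exact/jump_bound/grad_bounded.
  by rewrite ger0_norm; [exact: (prob_vectors_le1 y u qP)|exact: q0].
- by move=> s _; exact: density_cvg.
- by apply: om_sum => y _; apply: cvgM; [exact: density_cvg|exact: jump_limit].
Qed.

End Limit.

Lemma reduced_solution : exists (V q : R -> S -> U -> R),
  [/\ forall t, 0 <= t <= T -> prob_vectors (q t),
      forall t x u, 0 <= t <= T -> has_derivative T (fun s => V s x u) t
        (- (Hm x (nabla (fun y => V t y u) x) u + F x (q t) u)),
      forall x u, V T x u = G x (q T) u,
      forall t x u, 0 <= t <= T -> has_derivative T (fun s => q s x u) t
        (\sum_(y : S) q t y u * jump y (nabla (fun z => V t z u) y) u x) &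
      forall x u, q 0 x u = m0 x u].
Proof.
have [n_ [c_ [W_ H]]] := schemes_exist.
have h0 N : 0 < T / (n_ N)%:R by have [] := H N.
have hA N : T / (n_ N)%:R * (d.+1%:R * A) <= 1 by have [] := H N.
have nh N : (n_ N)%:R * (T / (n_ N)%:R) = T by have [] := H N.
have hN N : T / (n_ N)%:R <= T / N.+1%:R by have [] := H N.
have WS N : scheme (T / (n_ N)%:R) (n_ N) (c_ N) (W_ N) by have [_ _ _ _ []] := H N.
have cu N u : ball u N.+1%:R^-1 (c_ N u) by have [_ _ _ _ [_]] := H N; apply.
exists (value n_ W_), (density n_ c_ W_); split.
- exact: density_prob.
- exact: value_derivative.
- exact: value_final.
- exact: density_derivative.
- exact: density_init.
Qed.

End Scheme.

(** * Existence of a solution *)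

Theorem theorem4 (R : realType) (T : R) (d : nat) (U : pmetricType R)
    (mu : probability (borel U) R)
    (L : state d -> 'rV[R]_d.+1 -> U -> R)
    (F G : state d -> prob R (U * state d)%type -> U -> R)
    (m0 : state d -> U -> R) :
  0 < T ->
  compact [set: U] ->
  assumption1 L ->
  assumption2 mu F ->
  assumption2 mu G ->
  prob_vectors m0 ->
  exists (V : R -> state d -> U -> R)
         (m : R -> prob R (U * state d)%type)
         (q : R -> state d -> U -> R),
    mfg_solution T mu L F G m0 V m q.
Proof.
move=> T0 cU [dL [_ cL cdL [gamma gamma0 convL]]] aF aG m0P.
have [CF HF] := proj1 aF; have [CG HG] := proj1 aG.
have [B B0 HB] := running_cost_bound cU gamma0 cL cdL convL.
have CF0 : 0 <= CF by apply: le_trans (HF ord0 (law mu m0) point).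
have CG0 : 0 <= CG by apply: le_trans (HG ord0 (law mu m0) point).
pose C : R := CG + T * (B + CF) + 1.
have C0 : 0 < C by rewrite ltr_wpDl// addr_ge0// mulr_ge0 ?addr_ge0// ltW.
have [A A0 HA] := astar_bound cU gamma0 cL cdL convL (2 * C).
pose Hm x p u : R := - hamiltonian L x p u.
pose al x p u (y : state d) : R := astar L x p u ord0 y.
pose F' x q u : R := F x (law mu q) u.
pose G' x q u : R := G x (law mu q) u.
have [V [q [qP Vd VT qd q0]]] : exists (V q : R -> state d -> U -> R),
  [/\ forall t, 0 <= t <= T -> prob_vectors (q t),
      forall t x u, 0 <= t <= T -> has_derivative T (fun s => V s x u) t
        (- (Hm x (nabla (fun y => V t y u) x) u + F' x (q t) u)),
      forall x u, V T x u = G' x (q T) u,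
      forall t x u, 0 <= t <= T -> has_derivative T (fun s => q s x u) t
        (\sum_(y : state d) q t y u * jump al y (nabla (fun z => V t z u) y) u x) &
      forall x u, q 0 x u = m0 x u].
  apply: (@reduced_solution R d U cU T m0 Hm al F' G' A B CF CG C) => //.
  - by rewrite /C lerDl.
  - by move=> x q u; apply: HF.
  - by move=> x q u; apply: HG.
  - by move=> x p u y; apply: (astar_ge0 cU gamma0 cL cdL convL).
  - by move=> x p u y pb; apply: HA.
  - move=> x p u; apply: le_trans (hamiltonian_le cU gamma0 cL cdL convL x p u (@orthant0 R d)) _.
    rewrite /cost big1 ?add0r; first by have [] := HB x u.
    by move=> y _; rewrite mxE mul0r.
  - move=> x p u; rewrite /Hm (hamiltonianE cU gamma0 cL cdL convL) /cost lerD2l.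
    by have [_] := HB x u; apply; have [] := astarP cU gamma0 cL cdL convL x p u.
  - move=> x p p' u pb pb'; rewrite /Hm -opprD normrN.
    apply: (hamiltonian_lipschitz cU gamma0 cL cdL convL pb pb') => p'' pb''.
    exact: HA.
  - move=> x y p_ u_ p u pb pp uu.
    by have [+ _] := astar_cvg cU gamma0 cL cdL convL x pb pp uu; apply.
  - move=> x p_ u_ p u pb pp uu.
    by have [_] := astar_cvg cU gamma0 cL cdL convL x pb pp uu.
  - exact: assumption2_uniform.
  - exact: assumption2_uniform.
exists V, (fun t => law mu (q t)), q; split.
- move=> t; rewrite in_itv/= => tT; split; first exact/law_P_mu/qP.
  exact/law_disintegrates/qP.
- move=> t x u; rewrite in_itv/= => tT.
  by eexists; [exact: Vd|rewrite opprK].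
- exact: VT.
- by move=> t x u; rewrite in_itv/= => tT; exact: qd.
- exact: q0.
Qed.
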